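(* Let $\mathcal{X}=\{\mathbf{x}_1,\dots,\mathbf{x}_m\}\subset\mathbb{R}^d$, let $[m]=B\cup R$ be a partition, let $L_B,L_R$ be disjoint finite sets of group indices, and let $M>0$ be a fixed big constant. Let $S=\{i_1,\dots,i_s\}\subseteq B$ be such that $\mathbf{x}_S$ is an obstacle between $\mathbf{x}_{j_1},\mathbf{x}_{j_2}$ with $j_1,j_2\in R$, $j_1\ne j_2$, and let $k\in L_B$, $\ell\in L_R$. Then the inequality $$z_{j_1\ell}+z_{j_2\ell}+\sum_{i\in S}z_{ik}\le s+1$$ defines a facet of $P_{\mathcal{I}}$ if and only if $\mathbf{x}_S$ is a nontrivial minimal obstacle between $\mathbf{x}_{j_1}$ and $\mathbf{x}_{j_2}$.
   Context: $\mathbf{x}_S:=\{\mathbf{x}_i:i\in S\}$. Given distinct $\mathbf{y}_1,\mathbf{y}_2\in\mathbb{R}^d$, a set $Y\subseteq\mathbb{R}^d$ is an obstacle between $\mathbf{y}_1$ and $\mathbf{y}_2$ if $\operatorname{conv}(Y)\cap\operatorname{conv}(\{\mathbf{y}_1,\mathbf{y}_2\})\ne\emptyset$; it is trivial if $\mathbf{y}_1\in\operatorname{conv}(Y)$ or $\mathbf{y}_2\in\operatorname{conv}(Y)$ (nontrivial otherwise); it is minimal if $\operatorname{conv}(Y\setminus\{\mathbf{y}\})\cap\operatorname{conv}(\{\mathbf{y}_1,\mathbf{y}_2\})=\emptyset$ for every $\mathbf{y}\in Y$. The polyhedron $P_{\mathcal{I}}$ of the instance $\mathcal{I}=(\mathcal{X},B,R,L_B,L_R)$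 is the convex hull of all points $(\mathbf{p},q,z)$, where $\mathbf{p}=(\mathbf{p}_{k\ell})_{k\in L_B,\ell\in L_R}$ with $\mathbf{p}_{k\ell}\in\mathbb{R}^d$, $q=(q_{k\ell})$ with $q_{k\ell}\in\mathbb{R}$, and $z=(z_{ik})_{(i,k)\in(B\times L_B)\cup(R\times L_R)}$ with $z_{ik}\in\{0,1\}$, satisfying: $\mathbf{p}_{k\ell}\cdot\mathbf{x}_i+q_{k\ell}\le M-(M+1)z_{ik}$ for all $i\in B,k\in L_B,\ell\in L_R$; $\mathbf{p}_{k\ell}\cdot\mathbf{x}_j+q_{k\ell}\ge -M+(M+1)z_{j\ell}$ for all $j\in R,\ell\in L_R,k\in L_B$; $\sum_{k\in L_B}z_{ik}\le 1$ for all $i\in B$; $\sum_{\ell\in L_R}z_{j\ell}\le1$ for all $j\in R$. Here $\cdot$ is the standard inner product.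
   Formalization: The ''if'' direction is stated only when s ≥ 2 or |L_B| = 1, as it fails for s = 1 and |L_B| ≥ 2 (then z_{ik'} = 0 on the face for k' ≠ k); the points x_i are distinct and ''big'' M means M ≥ M_0 for a threshold M_0 depending on the instance. *)

(* Defs.v *)
From HB Require Import structures.
From mathcomp Require Import all_boot all_order all_algebra.
From mathcomp Require Import all_classical all_reals.

Set Implicit Arguments.
Unset Strict Implicit.
Unset Printing Implicit Defensive.

Import Order.TTheory GRing.Theory Num.Theory.
Local Open Scope classical_set_scope.
Local Open Scope ring_scope.

Section ConvexHull.
Context {R : realType} {V : lmodType R}.

Definition conv (A : set V) : set V :=
  [set y | exists (n : nat) (a : 'I_n -> R) (v : 'I_n -> V),
     [/\ forall i, 0 <= a i, \sum_(i < n) a i = 1, forall i, A (v i)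
       & y = \sum_(i < n) a i *: v i]].

Definition obstacle (Y : set V) (y1 y2 : V) : Prop :=
  conv Y `&` conv [set y1; y2] !=set0.

Definition trivial_obstacle (Y : set V) (y1 y2 : V) : Prop :=
  obstacle Y y1 y2 /\ (conv Y y1 \/ conv Y y2).

Definition nontrivial_obstacle (Y : set V) (y1 y2 : V) : Prop :=
  obstacle Y y1 y2 /\ ~ trivial_obstacle Y y1 y2.

Definition minimal_obstacle (Y : set V) (y1 y2 : V) : Prop :=
  obstacle Y y1 y2 /\
  forall y, Y y -> conv (Y `\ y) `&` conv [set y1; y2] = set0.

End ConvexHull.

Section Facet.
Context {R : realType} {V : vectType R}.

Definition affinely_independent (n : nat) (v : 'I_n.+1 -> V) : Prop :=
  free [seq v (lift ord0 i) - v ord0 | i <- enum 'I_n].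

(* The relation never holds for the empty set, whose dimension is -1. *)
Definition has_dim (A : set V) (n : nat) : Prop :=
  (exists v : 'I_n.+1 -> V, affinely_independent v /\ forall i, A (v i)) /\
  (forall (k : nat) (v : 'I_k.+1 -> V),
     affinely_independent v -> (forall i, A (v i)) -> (k <= n)%N).

Definition defines_facet (P : set V) (f : V -> R) (b : R) : Prop :=
  (forall y, P y -> f y <= b) /\
  exists n : nat, has_dim P n.+1 /\ has_dim (P `&` [set y | f y = b]) n.

End Facet.

Section Polyhedron.
Context {R : realType} {d m : nat}.
Variables (x : 'I_m -> 'rV[R]_d) (Blue Red : {set 'I_m}) (LB LR : finType).

Definition dot (u v : 'rV[R]_d) : R := \sum_(c < d) u 0 c * v 0 c.

Definition idx (A : {set 'I_m}) := {i : 'I_m | i \in A}.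

(* Only the pairs in (Blue x LB) u (Red x LR) index a variable z; the blue and
   the red family are separate components. *)
Definition var_space : vectType R :=
  ({ffun LB * LR -> 'rV[R]_d} * {ffun LB * LR -> R^o} *
   {ffun idx Blue * LB -> R^o} * {ffun idx Red * LR -> R^o})%type.

Definition pv (y : var_space) (k : LB) (l : LR) : 'rV[R]_d := y.1.1.1 (k, l).
Definition qv (y : var_space) (k : LB) (l : LR) : R := y.1.1.2 (k, l).
Definition zB (y : var_space) (i : idx Blue) (k : LB) : R := y.1.2 (i, k).
Definition zR (y : var_space) (j : idx Red) (l : LR) : R := y.2 (j, l).

Definition feasible (M : R) (y : var_space) : Prop :=
  (forall i k, zB y i k = 0 \/ zB y i k = 1) /\
  (forall j l, zR y j l = 0 \/ zR y j l = 1) /\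
  (forall i k l,
     dot (pv y k l) (x (val i)) + qv y k l <= M - (M + 1) * zB y i k) /\
  (forall j l k,
     dot (pv y k l) (x (val j)) + qv y k l >= - M + (M + 1) * zR y j l) /\
  (forall i, \sum_(k : LB) zB y i k <= 1) /\
  (forall j, \sum_(l : LR) zR y j l <= 1).

Definition polyhedron (M : R) : set var_space := conv (feasible M).

Definition points (S : {set idx Blue}) : set 'rV[R]_d :=
  [set x (val i) | i in [set` S]].

End Polyhedron.

(* Main.v *)
(* A (p, q)-constraint system with 0/1 labels is feasible, for a large enough
   big-M, as soon as every blue class can be separated from every red class;
   by Gordan's alternative this means that the convex hulls are disjoint, and
   there are finitely many pairs of classes to bound.

   Only if: when the inequality is not given by a nontrivial minimal obstacle,
   a proper part of the points (S and one red point, or S minus a point and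
   both red points) is already inseparable. The inequality is then the sum of
   two valid inequalities, and the face lies in two independent hyperplanes.

   If: the points of the face have all but one of the variables of the
   inequality equal to 1. For every other variable there is such a point where
   it equals 1, and it can be lowered to 0; together with small perturbations
   of (p, q) and the choice of the missing variable this spans a hyperplane.
   The convex geometry behind it is that for a nontrivial minimal obstacle S is
   affinely independent and no endpoint is in its affine hull: otherwise one
   could move the crossing point, inside conv(S) and along the segment, until a
   barycentric coordinate vanishes, against minimality. *)

Require Import Defs.
From HB Require Import structures.
From mathcomp Require Import all_boot all_order all_algebra.
From mathcomp Require Import all_classical all_reals.
From mathcomp Require Import ring lra.

Set Implicit Arguments.
Unset Strict Implicit.
Unset Printing Implicit Defensive.

Import Order.TTheory GRing.Theory Num.Theory.
Local Open Scope ring_scope.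

(** * Convex hulls and separation of finite families *)

Section FiniteConvexHull.
Local Open Scope classical_set_scope.
Context {R : realType} {V : lmodType R}.

(** Weights of points with the same chosen index are collected, so a convex combination of any
    length becomes one indexed by [A]. *)
Lemma conv_image_finP {I : finType} {f : I -> V} {A : {set I}} {y : V} :
  conv [set f i | i in [set` A]] y <->
  exists c : I -> R, [/\ forall i, 0 <= c i, \sum_(i in A) c i = 1
    & y = \sum_(i in A) c i *: f i].
Proof.
split=> [[n [a [v [a0 a1 vA ->]]]]|[c [c0 c1 ->]]].
  have /choice[h hP] : forall j, exists i, i \in A /\ f i = v j.
    by move=> j; have [i iA fi] := vA j; exists i.
  have hA j : true -> h j \in A by move=> _; case: (hP j).
  exists (fun i => \sum_(j | h j == i) a j); split=> [i||].
  - by apply: sumr_ge0 => j _.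
  - by rewrite -a1 (partition_big h (mem A) hA).
  - rewrite (partition_big h (mem A) hA); apply: eq_bigr => i _.
    rewrite scaler_suml; apply: eq_bigr => j /eqP <-.
    by case: (hP j) => _ ->.
exists #|A|, (fun j => c (enum_val j)), (fun j => f (enum_val j)); split=> //.
- by rewrite -c1 [RHS]big_enum_val.
- by move=> j; exists (enum_val j) => //; apply: enum_valP.
- by rewrite [LHS]big_enum_val.
Qed.

Lemma sub_conv (A B : set V) : A `<=` B -> conv A `<=` conv B.
Proof.
move=> AB y [n [a [v [a0 a1 vA ->]]]].
by exists n, a, v; split=> // i; apply: AB.
Qed.

Lemma conv_image_subset (I : finType) (f : I -> V) (A B : {set I}) :
  A \subset B ->
  conv [set f i | i in [set` A]] `<=` conv [set f i | i in [set` B]].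
Proof.
move=> /fintype.subsetP AB; apply: sub_conv => _ [i iA <-].
by exists i => //; exact: AB.
Qed.

Lemma mem_conv (A : set V) y : A y -> conv A y.
Proof.
move=> Ay; exists 1%N, (fun=> 1), (fun=> y); split=> //.
- by rewrite big_ord1.
- by rewrite big_ord1 scale1r.
Qed.

Lemma conv1 (y : V) : conv [set y] = [set y].
Proof.
apply/seteqP; split=> [z [n [a [v [_ a1 vy ->]]]]|z]; last exact: mem_conv.
under eq_bigr => i _ do rewrite (vy i).
by rewrite -scaler_suml a1 scale1r.
Qed.

Lemma conv_linear_le (f : {linear V -> R^o}) (b : R) (A : set V) :
  (forall y, A y -> f y <= b) -> forall y, conv A y -> f y <= b.
Proof.
move=> fb y [n [a [v [a0 a1 vA ->]]]]; rewrite linear_sum /=.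
rewrite -[leRHS]mul1r -a1 mulr_suml; apply: ler_sum => i _.
by rewrite linearZ /=; apply: ler_wpM2l => //; apply: fb.
Qed.

End FiniteConvexHull.

Section DotProduct.
Context {R : realType} {n : nat}.
Implicit Types u v w : 'rV[R]_n.

Lemma dotDl u v w : dot (u + v) w = dot u w + dot v w.
Proof. by rewrite -big_split; apply: eq_bigr => i _; rewrite mxE mulrDl. Qed.

Lemma dotZl a u v : dot (a *: u) v = a * dot u v.
Proof. by rewrite /dot mulr_sumr; apply: eq_bigr => i _; rewrite mxE mulrA. Qed.

Lemma dotC u v : dot u v = dot v u.
Proof. by apply: eq_bigr => i _; rewrite mulrC. Qed.

Lemma dotDr u v w : dot u (v + w) = dot u v + dot u w.
Proof. by rewrite dotC dotDl !(dotC u). Qed.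

Lemma dotZr a u v : dot u (a *: v) = a * dot u v.
Proof. by rewrite dotC dotZl dotC. Qed.

Lemma dotNr u v : dot u (- v) = - dot u v.
Proof. by rewrite -scaleN1r dotZr mulN1r. Qed.

Lemma dot0l v : dot 0 v = 0.
Proof. by rewrite -(scale0r 0) dotZl mul0r. Qed.

Lemma dot_sumr (I : finType) (P : pred I) (f : I -> 'rV[R]_n) u :
  dot u (\sum_(i | P i) f i) = \sum_(i | P i) dot u (f i).
Proof.
by apply: (big_morph (dot u)) => [v w|]; rewrite ?dotDr // dotC dot0l.
Qed.

Lemma dot_gt0 u : u != 0 -> 0 < dot u u.
Proof.
move=> u0; rewrite lt_neqAle eq_sym sumr_ge0 ?andbT; last first.
  by move=> i _; rewrite -expr2 sqr_ge0.
apply: contra u0; rewrite psumr_eq0; last by move=> i _; rewrite -expr2 sqr_ge0.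
move=> /allP u0; apply/eqP/rowP => i; rewrite mxE.
by have := u0 i (mem_index_enum i); rewrite mulf_eq0 orbb => /eqP.
Qed.

End DotProduct.

(** * Gordan's alternative and separation of finite families with a margin *)

Section Separation.
Local Open Scope classical_set_scope.
Context {R : realType}.

Lemma small_perturbation (I : finType) (A : {set I}) (a b : I -> R) :
  (forall i, i \in A -> 0 < a i) ->
  exists2 e, 0 < e & forall i, i \in A -> 0 < a i + e * b i.
Proof.
(* The sum [s] dominates every ratio [|b i| / a i], so [1 / (1 + s)] is a step that works for all
   indices at once. *)
move=> a0; pose s := \sum_(i in A) `|b i| / a i.
have s0 i : i \in A -> 0 <= `|b i| / a i.
  by move=> iA; rewrite divr_ge0 // ltW // a0.
have t0 : 0 < 1 + s by rewrite ltr_pwDl // sumr_ge0.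
exists (1 + s)^-1 => [|i iA]; first by rewrite invr_gt0.
have ai := a0 _ iA.
have bs : `|b i| < (1 + s) * a i.
  rewrite -ltr_pdivrMr // /s (bigD1 i) //= addrCA ltrDl ltr_pwDl //.
  by apply: sumr_ge0 => j /andP[jA _]; apply: s0.
have : `|b i| / (1 + s) < a i by rewrite ltr_pdivrMr // mulrC.
rewrite mulrC => h; rewrite -ltrBlDr sub0r; apply: le_lt_trans h.
by rewrite -mulrN ler_pM2l ?invr_gt0 // -normrN ler_norm.
Qed.

(* Induction on the number of vectors: if [w] is positive on all of them but
   [v i], project the others along [v i] onto the orthogonal of [w]. *)
Lemma gordan n (I : finType) (A : {set I}) (v : I -> 'rV[R]_n) :
  (exists w, forall i, i \in A -> 0 < dot w (v i)) \/
  (exists c : I -> R, [/\ forall i, 0 <= c i, 0 < \sum_(i in A) c i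
    & \sum_(i in A) c i *: v i = 0]).
Proof.
move: {2}#|A| (erefl #|A|) => k; elim: k A v => [|k IH] A v cA.
  by left; exists 0 => i; rewrite (cards0_eq cA) inE.
have /card_gt0P[i iA] : (0 < #|A|)%N by rewrite cA.
have cA' : #|A :\ i| = k by move: cA; rewrite (cardsD1 i) iA => -[].
have extend (c : I -> R) ci : (forall j, 0 <= c j) -> 0 <= ci ->
    0 < \sum_(j in A :\ i) c j + ci ->
    \sum_(j in A :\ i) c j *: v j + ci *: v i = 0 ->
    exists c : I -> R, [/\ forall i, 0 <= c i, 0 < \sum_(i in A) c i
      & \sum_(i in A) c i *: v i = 0].
  move=> c0 ci0 s0 sv0; exists (fun j => if j == i then ci else c j); split.
  - by move=> j; case: ifP.
  - rewrite (big_setD1 i) //= eqxx addrC.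
    under eq_bigr => j do rewrite !inE => /andP[/negbTE -> _].
    exact: s0.
  - rewrite (big_setD1 i) //= eqxx addrC.
    under eq_bigr => j do rewrite !inE => /andP[/negbTE -> _].
    exact: sv0.
have [vi0|vi0] := eqVneq (v i) 0.
  right; apply: (extend (fun=> 0) 1) => //; first by rewrite big1 ?add0r.
  by rewrite vi0 scaler0 addr0 big1 // => j _; rewrite scale0r.
(* A small multiple of [v i] makes such a [w] positive on [v i] too, while the other products stay
   positive. *)
have perturb w : dot w (v i) = 0 ->
    (forall j, j \in A :\ i -> 0 < dot w (v j)) ->
    exists w, forall i, i \in A -> 0 < dot w (v i).
  move=> wi wj.
  have [e e0 he] := small_perturbation (fun j => dot (v i) (v j)) wj.
  exists (w + e *: v i) => j jA; rewrite dotDl dotZl.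
  have [->|ji] := eqVneq j i; first by rewrite wi add0r mulr_gt0 // dot_gt0.
  by apply: he; rewrite !inE ji.
have [[w wP]|[c [c0 cs cv]]] := IH _ v cA'; last first.
  by right; apply: (extend c 0) => //; rewrite ?addr0 // scale0r addr0.
have [wi|wi|wi] := ltgtP (dot w (v i)) 0; last by left; apply: (perturb w).
(* With this [a j] the vector [v j + a j *: v i] is orthogonal to [w]. Its positivity keeps the
   coefficient of [v i] nonnegative when a vanishing combination of the projections is expanded. *)
- pose a j := - (dot w (v j) / dot w (v i)).
  have a0 j : j \in A :\ i -> 0 < a j.
    by move=> /wP wj; rewrite oppr_gt0 pmulr_rlt0 // invr_lt0.
  have [[u uP]|[c [c0 cs cv]]] := IH _ (fun j => v j + a j *: v i) cA'.
    (* Subtracting [t *: w] makes [u] orthogonal to [v i]; its product with [v j] is then that of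
       [u] with the projection of [v j]. *)
    left; pose t := dot u (v i) / dot w (v i).
    have wi0 : dot w (v i) != 0 by rewrite lt_eqF.
    apply: (perturb (u - t *: w)) => [|j jA].
      by rewrite dotDl -scaleNr dotZl /t mulNr divfK // subrr.
    have := uP j jA; rewrite dotDr dotZr dotDl -scaleNr dotZl.
    by congr (0 < _ + _); rewrite /a /t; ring.
  right; apply: (extend c (\sum_(j in A :\ i) c j * a j)) => //.
  + by apply: sumr_ge0 => j /a0 aj; rewrite mulr_ge0 // ltW.
  + apply: ltr_wpDr => //.
    by apply: sumr_ge0 => j /a0 aj; rewrite mulr_ge0 // ltW.
  + rewrite -{}[RHS]cv scaler_suml -big_split; apply: eq_bigr => j _ /=.
    by rewrite scalerDr scalerA.
- left; exists w => j jA; have [->//|ji] := eqVneq j i.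
  by apply: wP; rewrite !inE ji.
Qed.

(** Gordan's alternative is applied to the points lifted to height 1, those of [f] negated: a
    positive functional is a separating pair [(p, q)], and a vanishing combination is a common point
    of the hulls. Scaling gives the margin 2, which leaves room to perturb [(p, q)] and still keep
    margin 1. *)
Lemma finite_separation n (I J : finType) (f : I -> 'rV[R]_n)
    (g : J -> 'rV[R]_n) (A : {set I}) (C : {set J}) :
  conv [set f i | i in [set` A]] `&` conv [set g j | j in [set` C]] = set0 ->
  exists (p : 'rV[R]_n) (q : R),
    (forall i, i \in A -> dot p (f i) + q <= - 2) /\
    (forall j, j \in C -> 2 <= dot p (g j) + q).
Proof.
move=> fg0.
pose lift1 (z : 'rV[R]_n) : 'rV[R]_(n + 1) := row_mx z (const_mx 1).
pose v (s : I + J) := match s with inl i => - lift1 (f i) | inr j => lift1 (g j) end.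
pose E : {set I + J} :=
    finset (fun s => match s with inl i => i \in A | inr j => j \in C end).
have dotE (w : 'rV[R]_(n + 1)) z :
    dot w (lift1 z) = dot (lsubmx w) z + rsubmx w 0 0.
  rewrite -{1}[w]hsubmxK /dot big_split_ord /= big_ord1 !row_mxEr [const_mx _ _ _]mxE mulr1.
  by congr (_ + _); apply: eq_bigr => i _; rewrite !row_mxEl.
have [[w wP]|[c [c0 cs cv]]] := gordan E v.
  pose K := \sum_(s in E) 2 / dot w (v s).
  have KP s : s \in E -> 2 <= K * dot w (v s).
    move=> sE; rewrite -ler_pdivrMr ?wP // /K (bigD1 s) //= lerDl.
    by apply: sumr_ge0 => t /andP[tE _]; rewrite divr_ge0 // ltW // wP.
  exists (K *: lsubmx w), (K * rsubmx w 0 0); split=> [i iA|j jC].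
    have : 2 <= K * dot w (v (inl i)) by apply: KP; rewrite inE.
    by rewrite /= dotNr dotE dotZl; lra.
  have : 2 <= K * dot w (v (inr j)) by apply: KP; rewrite inE.
  by rewrite /= dotE dotZl mulrDr.
exfalso; move: cs cv.
have sumE (W : nmodType) (F : I + J -> W) : \sum_(s in E) F s =
    \sum_(i in A) F (inl i) + \sum_(j in C) F (inr j).
  by rewrite big_sumType; congr (_ + _); apply: eq_bigl => i; rewrite inE.
rewrite !sumE /= => cs.
under eq_bigr => i _ do rewrite scalerN.
rewrite sumrN addrC => /eqP; rewrite subr_eq0 => /eqP cv.
pose a := \sum_(i in A) c (inl i); pose b := \sum_(j in C) c (inr j).
(* The lifting coordinate shows that both sides carry the same total weight; dividing by it gives
   convex combinations. *)
have ab : b = a.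
  have := congr1 (fun z => rsubmx z 0 0) cv; rewrite !linear_sum !summxE.
  under eq_bigr => i _ do rewrite linearZ /= row_mxKr !mxE mulr1.
  by under [X in _ = X -> _]eq_bigr => i _ do rewrite linearZ /= row_mxKr !mxE mulr1.
have a0 : 0 < a by move: cs; rewrite -/a -/b ab; lra.
have fg : \sum_(j in C) c (inr j) *: g j = \sum_(i in A) c (inl i) *: f i.
  have := congr1 lsubmx cv; rewrite !linear_sum.
  under eq_bigr => i _ do rewrite linearZ /= row_mxKl.
  by under [X in _ = X -> _]eq_bigr => i _ do rewrite linearZ /= row_mxKl.
suff : (conv [set f i | i in [set` A]] `&` conv [set g j | j in [set` C]])
    (a^-1 *: \sum_(i in A) c (inl i) *: f i) by rewrite fg0.
split.
  apply/conv_image_finP; exists (fun i => a^-1 * c (inl i)); split.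
  - by move=> i; rewrite mulr_ge0 // invr_ge0 ltW.
  - by rewrite -mulr_sumr mulVf // gt_eqF.
  - by rewrite scaler_sumr; apply: eq_bigr => i _; rewrite scalerA.
rewrite -fg; apply/conv_image_finP; exists (fun i => a^-1 * c (inr i)); split.
- by move=> i; rewrite mulr_ge0 // invr_ge0 ltW.
- by rewrite -mulr_sumr -/b ab mulVf // gt_eqF.
- by rewrite scaler_sumr; apply: eq_bigr => i _; rewrite scalerA.
Qed.

End Separation.

(** * Minimal obstacles *)

Section Apart.
Local Open Scope classical_set_scope.
Context {R : realType} {V : lmodType R} {I J : finType}.
Variables (f : I -> V) (g : J -> V).

Definition apart (A : {set I}) (C : {set J}) : Prop :=
  conv [set f i | i in [set` A]] `&` conv [set g j | j in [set` C]] = set0.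

(** Signs matter only on [A] and [C], since coefficients can be cut to 0 elsewhere; crossings can
    then be built without care for the other indices. *)
Lemma not_apartP (A : {set I}) (C : {set J}) :
  ~ apart A C <->
  exists (c : I -> R) (e : J -> R),
    [/\ forall i, i \in A -> 0 <= c i, forall j, j \in C -> 0 <= e j,
        \sum_(i in A) c i = 1, \sum_(j in C) e j = 1
      & \sum_(i in A) c i *: f i = \sum_(j in C) e j *: g j].
Proof.
split.
  move=> /eqP/set0P[z [/conv_image_finP[c [c0 c1 cz]] /conv_image_finP[e [e0 e1 ez]]]].
  by exists c, e; split=> //; rewrite -cz -ez.
move=> [c [e [c0 e0 c1 e1 ce]]] /eqP; apply/negP/set0P.
exists (\sum_(i in A) c i *: f i); split.
  apply/conv_image_finP; exists (fun i => if i \in A then c i else 0); split.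
  - by move=> i; case: ifP => // /c0.
  - by rewrite -c1; apply: eq_bigr => i ->.
  - by apply: eq_bigr => i ->.
rewrite ce; apply/conv_image_finP; exists (fun i => if i \in C then e i else 0).
split.
- by move=> i; case: ifP => // /e0.
- by rewrite -e1; apply: eq_bigr => i ->.
- by apply: eq_bigr => i ->.
Qed.

Lemma apart_subset (A A' : {set I}) (C C' : {set J}) :
  A' \subset A -> C' \subset C -> apart A C -> apart A' C'.
Proof.
move=> sA sC; apply: contraPP => /eqP/set0P[z [zA zC]].
apply/eqP/set0P; exists z; split.
- exact: conv_image_subset sA _ zA.
- exact: conv_image_subset sC _ zC.
Qed.

Lemma apart0l C : apart finset.set0 C.
Proof.
apply: contrapT => /not_apartP[c [e [_ _ + _ _]]].
by rewrite big_set0 => /eqP; rewrite eq_sym oner_eq0.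
Qed.

Lemma apart0r A : apart A finset.set0.
Proof.
apply: contrapT => /not_apartP[c [e [_ _ _ + _]]].
by rewrite big_set0 => /eqP; rewrite eq_sym oner_eq0.
Qed.

Lemma apart1P (A : {set I}) j :
  apart A [set j]%SET <-> ~ conv [set f i | i in [set` A]] (g j).
Proof.
rewrite /apart (_ : [set g i | i in [set` [set j]%SET]] = [set g j]) ?conv1; last first.
  apply/seteqP; split=> [z [i /= + <-]|_ ->]; first by rewrite inE => /eqP ->.
  by exists j => //=; rewrite inE.
split=> [Aj jA|jA]; first by suff : set0 (g j) by []; rewrite -Aj.
by apply/seteqP; split=> // z [zA /= zj]; apply: jA; rewrite -zj.
Qed.

End Apart.

(** Nontrivial minimal obstacles in terms of index sets, so that removing a point is removing an
    index and each condition is an instance of [apart]. *)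
Record minimal_crossing {R : realType} {V : lmodType R} {I J : finType}
    (f : I -> V) (g : J -> V) (S : {set I}) (j1 j2 : J) : Prop := {
  crossing_neq : j1 != j2;
  crossing_meets : ~ apart f g S [set j1; j2];
  crossing_minimal : forall t, t \in S -> apart f g (S :\ t) [set j1; j2];
  crossing_outside1 : apart f g S [set j1];
  crossing_outside2 : apart f g S [set j2]
}.

Section MinimalObstacle.
Context {R : realType} {n : nat} {I J : finType}.
Variables (f : I -> 'rV[R]_n) (g : J -> 'rV[R]_n).

(** The ratio test of the simplex method: moving from [o] along [u], the first coordinate to vanish
    is one that minimizes [o i / - u i] among those with [u i < 0]. *)
Lemma push_to_boundary (S : {set I}) (o u : I -> R) i :
  (forall i, i \in S -> 0 <= o i) -> i \in S -> u i < 0 ->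
  exists t a, [/\ 0 <= a, t \in S, o t + a * u t = 0
    & forall i, i \in S -> 0 <= o i + a * u i].
Proof.
move=> o0 iS ui.
have P0 : [pred i | (i \in S) && (u i < 0)] i by rewrite /= iS ui.
case: (Order.TotalTheory.arg_minP (fun i => o i / - u i) P0).
move=> t /= /andP[tS ut] tmin; exists t, (o t / - u t).
have ut' : 0 < - u t by rewrite oppr_gt0.
have a0 : 0 <= o t / - u t by rewrite divr_ge0 ?o0 // ltW.
split=> //.
  by rewrite -[X in _ * X]opprK mulrN divfK ?subrr // gt_eqF.
move=> s sS; have [us|us] := ltP (u s) 0; last by apply: addr_ge0 (o0 _ sS) (mulr_ge0 a0 us).
have := tmin s; rewrite /= sS us => /(_ isT).
by rewrite ler_pdivlMr ?oppr_gt0 // mulrN; lra.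
Qed.

Lemma not_apart1P (A : {set I}) j :
  ~ apart f g A [set j] <->
  exists c : I -> R, [/\ forall i, i \in A -> 0 <= c i, \sum_(i in A) c i = 1
    & \sum_(i in A) c i *: f i = g j].
Proof.
rewrite not_apartP; split=> [[c [e [c0 e0 c1]]]|[c [c0 c1 cj]]].
  rewrite !big_set1 => ->; rewrite scale1r => cj.
  by exists c.
by exists c, (fun=> 1); split=> //; rewrite !big_set1 // scale1r.
Qed.

Variables (S : {set I}) (j1 j2 : J).

(** Signed combinations with their total weight [w]; weight 1 means membership in the affine hull.
    Keeping the weight allows elimination without normalizing at each step. *)
Definition combination w z :=
  exists c : I -> R, \sum_(i in S) c i = w /\ \sum_(i in S) c i *: f i = z.

Lemma combinationD w z w' z' :
  combination w z -> combination w' z' -> combination (w + w') (z + z').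
Proof.
move=> [c [<- <-]] [c' [<- <-]]; exists (fun i => c i + c' i).
by rewrite -!big_split; split=> //; apply: eq_bigr => i _; rewrite scalerDl.
Qed.

Lemma combinationZ a w z : combination w z -> combination (a * w) (a *: z).
Proof.
move=> [c [<- <-]]; exists (fun i => a * c i).
by rewrite mulr_sumr scaler_sumr; split=> //; apply: eq_bigr => i _; rewrite scalerA.
Qed.

Lemma combinationV a z : a != 0 -> combination a (a *: z) -> combination 1 z.
Proof. by move=> a0 /(combinationZ a^-1); rewrite scalerA mulVf // scale1r. Qed.

Hypothesis crossing : minimal_crossing f g S j1 j2.

Let j12 := crossing_neq crossing.
Let S_meets := crossing_meets crossing.
Let S_minimal := crossing_minimal crossing.
Let j1_outside := crossing_outside1 crossing.
Let j2_outside := crossing_outside2 crossing.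

(** A vanishing coefficient at [t] would be a crossing of [S :\ t], against minimality. *)
Lemma segment_coef_gt0 (c : I -> R) a :
  (forall i, i \in S -> 0 <= c i) -> \sum_(i in S) c i = 1 -> 0 <= a <= 1 ->
  \sum_(i in S) c i *: f i = a *: g j1 + (1 - a) *: g j2 ->
  forall t, t \in S -> 0 < c t.
Proof.
have j21 : (j2 == j1) = false by rewrite eq_sym (negbTE j12).
move=> c0 c1 /andP[a0 a1] ca t tS; rewrite lt_neqAle c0 // andbT.
apply/eqP => ct; have := S_minimal tS; apply/not_apartP.
exists c, (fun j => if j == j1 then a else 1 - a); split.
- by move=> i /setD1P[_ /c0].
- by move=> j _; case: ifP; rewrite ?subr_ge0.
- by rewrite -c1 (big_setD1 t tS) -ct /= add0r.
- by rewrite big_setU1 ?inE // big_set1 eqxx j21 /= addrC subrK.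
- rewrite big_setU1 ?inE // big_set1 eqxx j21 /= -ca.
  by rewrite (big_setD1 t tS) -ct /= scale0r add0r.
Qed.

(** At [mu = 0] or [mu = 1] an endpoint would lie in the hull of [S]. *)
Lemma crossing_point :
  exists (o : I -> R) mu, [/\ forall i, i \in S -> 0 < o i,
    \sum_(i in S) o i = 1, 0 < mu < 1
    & \sum_(i in S) o i *: f i = mu *: g j1 + (1 - mu) *: g j2].
Proof.
have /not_apartP[o [e [o0 e0 o1]]] := S_meets.
rewrite !big_setU1 ?inE // !big_set1 /= => e12 oe.
have e2 : e j2 = 1 - e j1 by move: e12 => /=; lra.
rewrite e2 in oe; have e10 : 0 <= e j1 by apply: e0; rewrite !inE eqxx.
have e11 : e j1 <= 1 by rewrite -subr_ge0 -e2 e0 // !inE eqxx orbT.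
exists o, (e j1); split=> //; first by apply: (segment_coef_gt0 (a := e j1)); rewrite ?e10.
apply/andP; split; rewrite lt_neqAle ?e10 ?e11 andbT.
  apply/eqP => e1; move: j2_outside; apply/not_apart1P; exists o; split=> //.
  by rewrite oe -e1 scale0r add0r subr0 scale1r.
apply/eqP => e1; move: j1_outside; apply/not_apart1P; exists o; split=> //.
by rewrite oe e1 scale1r subrr scale0r addr0.
Qed.

(** An affine dependence changes the coefficients of the crossing point without moving it. A
    negative entry would drive some coefficient to 0; applied to [c] and to [- c], this leaves only
    zeros. *)
Lemma minimal_affinely_independent (c : I -> R) :
  \sum_(i in S) c i = 0 -> \sum_(i in S) c i *: f i = 0 ->
  forall i, i \in S -> c i = 0.
Proof.
have [o [mu [o0 o1 /andP[/ltW mu0 /ltW mu1] ofE]]] := crossing_point.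
have nneg (u : I -> R) : \sum_(i in S) u i = 0 -> \sum_(i in S) u i *: f i = 0 ->
    forall i, i \in S -> 0 <= u i.
  move=> u0 uf i iS; rewrite leNgt; apply/negP => ui.
  have [t [a [a0 tS ta ua]]] := push_to_boundary (fun i iS => ltW (o0 i iS)) iS ui.
  suff : 0 < o t + a * u t by rewrite ta ltxx.
  apply: (@segment_coef_gt0 (fun i => o i + a * u i) mu) => //.
  - by rewrite big_split /= -mulr_sumr o1 u0 mulr0 addr0.
  - by rewrite mu0 mu1.
  - under eq_bigr => j _ do rewrite scalerDl -scalerA.
    by rewrite big_split /= -scaler_sumr uf scaler0 addr0.
move=> c0 cf i iS; apply/le_anti; rewrite nneg // andbT -oppr_ge0.
apply: (nneg (fun i => - c i)) => //; first by rewrite sumrN c0 oppr0.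
by under eq_bigr do rewrite scaleNr; rewrite sumrN cf oppr0.
Qed.

Lemma endpoint_not_combination : ~ combination 1 (g j1).
Proof.
move=> [c [c1 cj]].
have [o [mu [o0 o1 /andP[mu0 mu1] ofE]]] := crossing_point.
have [/existsP[i /andP[iS ci]]|/existsPn c0] :=
    boolP [exists i, (i \in S) && (c i < 0)]; last first.
  move: j1_outside; apply/not_apart1P; exists c; split=> // i iS.
  by have := c0 i; rewrite iS leNgt.
have oi := o0 _ iS.
have ui : c i - o i < 0 by lra.
have [t [a [a0 tS ta ua]]] := push_to_boundary (u := fun i => c i - o i)
  (fun i iS => ltW (o0 i iS)) iS ui.
(* Moving towards [g j1], the coefficient at [i] is already [c i < 0] at [a = 1], so the first zero
   is met while still on the segment, where [g j1] has weight [mu + a * (1 - mu)]. *)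
have a1 : a <= 1.
  by rewrite leNgt; apply/negP => a1; have := ua i iS; nra.
suff : 0 < o t + a * (c t - o t) by rewrite ta ltxx.
apply: (@segment_coef_gt0 (fun i => o i + a * (c i - o i)) (mu + a * (1 - mu))) => //.
- by rewrite big_split /= -mulr_sumr sumrB o1 c1 subrr mulr0 addr0.
- by apply/andP; split; nra.
- under eq_bigr => j _ do rewrite scalerDl -scalerA scalerBl.
  rewrite big_split /= -scaler_sumr sumrB ofE cj.
  by apply/rowP => s; rewrite !mxE; ring.
Qed.

End MinimalObstacle.

(** * Adding one more point to a minimal crossing *)

Section AddingAPoint.
Context {R : realType} {n : nat} {I J : finType}.
Variables (f : I -> 'rV[R]_n) (g : J -> 'rV[R]_n) (S : {set I}) (j1 j2 : J).
Hypothesis crossing : minimal_crossing f g S j1 j2.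

(** If both endpoints were in the hull of [i |: S], each would use [f i] with positive weight.
    Mixing the two representations as in the crossing point puts [f i], and then [g j1], in the
    affine hull of [S]. *)
Lemma endpoints_apart_add i :
  exists2 j, j \in [set j1; j2] & apart f g (i |: S) [set j].
Proof.
have [//|h1] := pselect (apart f g (i |: S) [set j1]).
  by exists j1 => //; rewrite !inE eqxx.
have [//|h2] := pselect (apart f g (i |: S) [set j2]).
  by exists j2 => //; rewrite !inE eqxx orbT.
exfalso.
have iS : i \notin S.
  apply/negP => iS; apply: h1.
  by rewrite (finset.setUidPr _) ?finset.sub1set //; apply: crossing_outside1 crossing.
have decompose j : ~ apart f g (i |: S) [set j] -> apart f g S [set j] ->
    exists2 a, 0 < a & combination f S (1 - a) (g j - a *: f i).
  move=> /not_apart1P[c [c0]]; rewrite !big_setU1 //= => c1 cj Sj.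
  have ci : 0 <= c i by apply: c0; rewrite !inE eqxx.
  exists (c i).
    rewrite lt_neqAle ci andbT; apply/eqP => ci0; move: Sj; apply/not_apart1P.
    exists c; split=> [t tS||]; first by apply: c0; rewrite !inE tS orbT.
      by move: c1; rewrite -ci0 add0r.
    by move: cj; rewrite -ci0 scale0r add0r.
  exists c; split; first by move: c1 => /=; lra.
  by rewrite -cj addrC addrK.
have [a a0 aP] := decompose _ h1 (crossing_outside1 crossing).
have [b b0 bP] := decompose _ h2 (crossing_outside2 crossing).
have [o [mu [_ o1 /andP[mu0 mu1] ofE]]] := crossing_point crossing.
have oP : combination f S 1 (mu *: g j1 + (1 - mu) *: g j2) by exists o.
(* [d] is the weight of [f i] in the mixture [mu *: g j1 + (1 - mu) *: g j2] of the two
   representations. *)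
pose d := mu * a + (1 - mu) * b.
have d0 : 0 < d by rewrite /d; nra.
have dP : combination f S d (d *: f i).
  have := combinationD oP (combinationD (combinationZ (- mu) aP)
    (combinationZ (mu - 1) bP)).
  congr (combination _ _ _ _); first by rewrite /d; ring.
  by apply/rowP => s; rewrite !mxE /d; ring.
apply: (endpoint_not_combination crossing).
have := combinationD aP (combinationZ a (combinationV (lt0r_neq0 d0) dP)).
by rewrite mulr1 !subrK.
Qed.

Lemma not_apart_setD1 t C : t \in S -> ~ apart f g (S :\ t) C ->
  exists (c : I -> R) (e : J -> R),
    [/\ forall i, i \in S -> 0 <= c i, c t = 0, \sum_(i in S) c i = 1
      & [/\ forall j, j \in C -> 0 <= e j, \sum_(j in C) e j = 1
          & \sum_(i in S) c i *: f i = \sum_(j in C) e j *: g j]].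
Proof.
move=> tS /not_apartP[c [e [c0 e0 c1 e1 ce]]].
have off i : i \in S :\ t -> (if i == t then 0 else c i) = c i.
  by rewrite !inE => /andP[/negbTE ->].
exists (fun i => if i == t then 0 else c i), e; split.
- by move=> i iS; case: eqVneq => // it; apply: c0; rewrite !inE it.
- by rewrite eqxx.
- by rewrite (big_setD1 t tS) eqxx /= add0r -[RHS]c1; apply: eq_bigr.
split=> //; rewrite (big_setD1 t tS) eqxx /= scale0r add0r -ce.
by apply: eq_bigr => i /off ->.
Qed.

(** By affine independence [g j] has at most one family of barycentric coordinates, and these cannot
    all vanish. *)
Lemma vertex_apart j : exists2 t, t \in S & apart f g (S :\ t) [set j].
Proof.
apply: contrapT => no_t.
have coef t : t \in S -> exists c : I -> R, [/\ forall i, i \in S -> 0 <= c i,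
    c t = 0, \sum_(i in S) c i = 1 & \sum_(i in S) c i *: f i = g j].
  move=> tS; have : ~ apart f g (S :\ t) [set j] by move=> h; apply: no_t; exists t.
  move=> /(not_apart_setD1 tS)[c [e [c0 ct c1 []]]].
  by rewrite !big_set1 => _ -> cj; exists c; rewrite scale1r in cj.
have pos (c : I -> R) : (forall i, i \in S -> 0 <= c i) ->
    \sum_(i in S) c i = 1 -> exists2 i, i \in S & 0 < c i.
  move=> c0 c1; apply: contrapT => h.
  suff : \sum_(i in S) c i = 0 by rewrite c1 => /eqP; rewrite oner_eq0.
  apply: big1 => i iS; apply/le_anti; rewrite c0 // andbT leNgt.
  by apply/negP => ci; apply: h; exists i.
(* The weights of the crossing point sum to 1, so [S] is nonempty. *)
have [o [mu [o0 o1 _ _]]] := crossing_point crossing.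
have [t tS _] := pos o (fun i iS => ltW (o0 i iS)) o1.
have [c [c0 _ c1 cj]] := coef t tS.
have [s sS cs] := pos c c0 c1.
have [e [_ es e1 ej]] := coef s sS.
suff : c s - e s = 0 by rewrite es; lra.
apply: (minimal_affinely_independent crossing (c := fun i => c i - e i)) => //.
  by rewrite sumrB c1 e1 subrr.
by under eq_bigr do rewrite scalerBl; rewrite sumrB cj ej subrr.
Qed.

(** Each alternative leaves room for [j] next to all but one of the points of the crossing. If all
    three fail, [g j] itself lies in the hull of [S], and uniqueness of barycentric coordinates
    rules out a crossing of [S :\ t] with the three red points when [g j] has positive weight at
    [t]. *)
Lemma crossing_apart_add j : j \notin [set j1; j2] ->
  [\/ apart f g S [set j1; j], apart f g S [set j2; j]
    | exists2 t, t \in S & apart f g (S :\ t) (j |: [set j1; j2])].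
Proof.
rewrite !inE negb_or => /andP[jj1 jj2].
have [|h1] := pselect (apart f g S [set j1; j]); first by constructor 1.
have [|h2] := pselect (apart f g S [set j2; j]); first by constructor 2.
constructor 3; apply: contrapT => no_t.
have [o [mu [o0 o1 /andP[mu0 mu1] ofE]]] := crossing_point crossing.
have oP : combination f S 1 (mu *: g j1 + (1 - mu) *: g j2) by exists o.
have jn := endpoint_not_combination crossing.
have decompose h : h != j -> ~ apart f g S [set h; j] -> apart f g S [set h] ->
    exists2 a, 0 <= a < 1 &
    exists c : I -> R, [/\ forall i, i \in S -> 0 <= c i, \sum_(i in S) c i = 1
      & \sum_(i in S) c i *: f i = a *: g h + (1 - a) *: g j].
  move=> hj /not_apartP[c [e [c0 e0 c1]]].
  rewrite !big_setU1 ?inE // !big_set1 /= => e1 ce Sh.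
  have e2 : e j = 1 - e h by move: e1 => /=; lra.
  rewrite e2 in ce; exists (e h); last by exists c.
  have eh : 0 <= e h by apply: e0; rewrite !inE eqxx.
  have ej : 0 <= e j by apply: e0; rewrite !inE eqxx orbT.
  rewrite eh /= lt_neqAle; apply/andP; split; last by rewrite -subr_ge0 -e2.
  apply/eqP => eh1; move: Sh; apply/not_apart1P; exists c; split=> //.
  by rewrite ce eh1 scale1r subrr scale0r addr0.
have [a /andP[a0 a1] [v [v0 v1 vE]]] :
    exists2 a, 0 <= a < 1 & exists c : I -> R,
      [/\ forall i, i \in S -> 0 <= c i, \sum_(i in S) c i = 1
      & \sum_(i in S) c i *: f i = a *: g j1 + (1 - a) *: g j].
  by apply: decompose => //; [rewrite eq_sym|exact: crossing_outside1 crossing].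
have [b /andP[b0 b1] [u [u0 u1 uE]]] :
    exists2 b, 0 <= b < 1 & exists c : I -> R,
      [/\ forall i, i \in S -> 0 <= c i, \sum_(i in S) c i = 1
      & \sum_(i in S) c i *: f i = b *: g j2 + (1 - b) *: g j].
  by apply: decompose => //; [rewrite eq_sym|exact: crossing_outside2 crossing].
have vP : combination f S 1 (a *: g j1 + (1 - a) *: g j) by exists v.
have uP : combination f S 1 (b *: g j2 + (1 - b) *: g j) by exists u.
(* Eliminating [g j] and [g j2] from the three combinations leaves a multiple
   of [g j1], whose coefficient must vanish. *)
have aE0 : a = 0.
  apply: contrapT => /eqP an0; apply: jn.
  pose K := a * (1 - b) * (1 - mu) + (1 - a) * b * mu.
  have ap : 0 < a by rewrite lt_neqAle eq_sym an0.
  have K0 : 0 < K.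
    apply: ltr_pwDl; first by rewrite !mulr_gt0 //; lra.
    by rewrite !mulr_ge0 //; lra.
  apply: (combinationV (lt0r_neq0 K0)).
  have := combinationD (combinationZ ((1 - b) * (1 - mu)) vP)
    (combinationD (combinationZ (- ((1 - a) * (1 - mu))) uP)
      (combinationZ ((1 - a) * b) oP)).
  congr (combination _ _ _ _); first by rewrite /K; ring.
  by apply/rowP => s; rewrite !mxE /K; ring.
rewrite aE0 scale0r add0r subr0 scale1r in vE.
have [t tS vt] : exists2 t, t \in S & 0 < v t.
  apply: contrapT => h.
  suff : \sum_(i in S) v i = 0 by rewrite v1 => /eqP; rewrite oner_eq0.
  apply: big1 => i iS; apply/le_anti; rewrite v0 // andbT leNgt.
  by apply/negP => vi; apply: h; exists i.
have : ~ apart f g (S :\ t) (j |: [set j1; j2]) by move=> h; apply: no_t; exists t.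
move=> /(not_apart_setD1 tS)[w [e [w0 wt w1 [e0]]]].
rewrite !big_setU1 ?inE ?(crossing_neq crossing) ?negb_or ?jj1 //.
rewrite !big_set1 /= => e1 wE.
have ej : 0 <= e j by apply: e0; rewrite !inE eqxx.
have ej1 : 0 <= e j1 by apply: e0; rewrite !inE eqxx orbT.
have ej2 : 0 <= e j2 by apply: e0; rewrite !inE eqxx !orbT.
have wP : combination f S 1 (e j *: g j + (e j1 *: g j1 + e j2 *: g j2)) by exists w.
have jP : combination f S 1 (g j) by exists v.
(* Otherwise eliminating [g j] and [g j2] leaves a nonzero multiple of [g j1]. Hence the [j1, j2]
   part of [w] is a multiple of the crossing point. *)
have balance : e j1 * (1 - mu) = e j2 * mu.
  apply: contrapT => /eqP bn; apply: jn.
  apply: (@combinationV _ _ _ _ _ (e j1 * (1 - mu) - e j2 * mu)).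
    by rewrite subr_eq0.
  have := combinationD (combinationZ (1 - mu) wP)
    (combinationD (combinationZ (- (e j2)) oP) (combinationZ (- ((1 - mu) * e j)) jP)).
  have -> : e j2 = 1 - e j - e j1 by move: e1 => /=; lra.
  congr (combination _ _ _ _); first by ring.
  by apply/rowP => s; rewrite !mxE; ring.
have e12 : e j1 = (e j1 + e j2) * mu by lra.
have e21 : e j2 = (e j1 + e j2) * (1 - mu) by lra.
(* Barycentric coordinates are unique. As [w t = 0] while [o t] and [v t] are positive, all weights
   [e] vanish, although they sum to 1. *)
have : w t - (e j1 + e j2) * o t - e j * v t = 0.
  apply: (minimal_affinely_independent crossing
    (c := fun i => w i - (e j1 + e j2) * o i - e j * v i)) => //.
    by rewrite !sumrB -!mulr_sumr w1 o1 v1; move: e1 => /=; lra.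
  under eq_bigr do rewrite !scalerBl -!scalerA.
  rewrite !sumrB -!scaler_sumr wE ofE vE.
  by apply/rowP => s; rewrite !mxE {1}e12 {2}e21; ring.
have ot := o0 t tS.
rewrite wt => wt0; have : e j * v t <= 0 by nra.
rewrite pmulr_lle0 // => ej'; have e0j : e j = 0 by lra.
have : (e j1 + e j2) * o t <= 0 by nra.
by rewrite pmulr_lle0 //; move: e1 => /=; lra.
Qed.

End AddingAPoint.

(** * Dimension and facets *)

Section Dimension.
Context {R : realType} {V : vectType R}.
Implicit Types (A : set V) (U W : {vspace V}) (X : seq V).

Lemma affinely_independent_leq n (v : 'I_n.+1 -> V) U :
  affinely_independent v -> (forall i, v i - v ord0 \in U) -> (n <= \dim U)%N.
Proof.
rewrite /affinely_independent /free size_map size_enum_ord => /eqP/= dimv vU.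
rewrite -[leqLHS]dimv.
by apply/dimvS/span_subvP => _ /mapP[i _ ->]; apply: vU.
Qed.

Lemma affinely_independent_seq a0 X :
  free [seq x - a0 | x <- X] ->
  affinely_independent (fun i : 'I_(size X).+1 => nth 0 (a0 :: X) i).
Proof.
rewrite /affinely_independent; congr (is_true (free _)).
apply: (@eq_from_nth _ 0); first by rewrite size_map [RHS]size_map size_enum_ord.
move=> i; rewrite size_map => iX.
rewrite (nth_map 0) // (nth_map (Ordinal iX)) ?size_enum_ord //=.
by rewrite nth_enum_ord.
Qed.

(** Independent differences to [a0] are collected greedily: while there are fewer than [n], their
    span cannot contain all differences of [A]. The space [U] bounds the number from above. *)
Lemma has_dim_intro A a0 n :
  A a0 ->
  (exists2 U, \dim U = n & forall a b, A a -> A b -> a - b \in U) ->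
  (forall W, (forall a b, A a -> A b -> a - b \in W) -> (n <= \dim W)%N) ->
  has_dim A n.
Proof.
move=> Aa0 [U dimU AU] minn; split; last first.
  move=> k v vfree vA; rewrite -dimU.
  by apply: affinely_independent_leq vfree _ => i; apply: AU.
have [X [sX XA freeX]] : exists X, [/\ size X = n, forall x, x \in X -> A x
    & free [seq x - a0 | x <- X]].
  suff {dimU} : forall k, (k <= n)%N -> exists X, [/\ size X = k,
      forall x, x \in X -> A x & free [seq x - a0 | x <- X]] by exact.
  elim=> [|k IH] kn; first by exists [::]; rewrite /= nil_free.
  have [X [sX XA freeX]] := IH (ltnW kn).
  pose W := <<[seq x - a0 | x <- X]>>%VS.
  have [a [Aa aW]] : exists a, A a /\ a - a0 \notin W.
    apply: contrapT => h; suff : (n <= \dim W)%N.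
      by move: freeX; rewrite /free size_map sX => /eqP ->; rewrite leqNgt kn.
    have inW a : A a -> a - a0 \in W.
      by move=> Aa; apply: contrapT => /negP aW; apply: h; exists a.
    apply: minn => a b Aa Ab.
    have -> : a - b = (a - a0) - (b - a0) by rewrite opprB addrA subrK.
    by apply: rpredB; apply: inW.
  exists (a :: X); split=> [|x|]; first by rewrite /= sX.
    by rewrite inE => /predU1P[->|/XA].
  by rewrite /= free_cons aW.
exists (fun i : 'I_n.+1 => nth 0 (a0 :: X) i); split.
  by move: (affinely_independent_seq freeX); rewrite sX.
move=> [[|i] /= iX] //; apply: XA; apply: mem_nth.
by rewrite sX -ltnS.
Qed.

Lemma has_dim_uniq A n k : has_dim A n -> has_dim A k -> n = k.
Proof.
move=> [[v [vfree vA]] nmax] [[w [wfree wA]] kmax].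
by apply/eqP; rewrite eqn_leq (kmax _ v) // (nmax _ w).
Qed.

Lemma has_dim_full A a0 :
  A a0 ->
  (forall W, (forall a b, A a -> A b -> a - b \in W) -> forall y, y \in W) ->
  has_dim A (\dim {:V}).
Proof.
move=> Aa0 fullA; apply: (has_dim_intro Aa0).
  by exists fullv => // a b _ _; apply: memvf.
by move=> W /fullA Wfull; apply/dimvS/subvP => y _.
Qed.

Lemma lker_linfun (f : {linear V -> R^o}) y : (y \in lker (linfun f)) = (f y == 0).
Proof. by rewrite memv_ker lfunE. Qed.

(** The differences lie in the kernel of [f], of codimension 1 because [f e = 1]; conversely their
    span needs only [e] to fill the space. *)
Lemma has_dim_hyperplane A a0 (f : {linear V -> R^o}) b e :
  A a0 -> (forall a, A a -> f a = b) -> f e = 1 ->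
  (forall W, (forall a b, A a -> A b -> a - b \in W) ->
    forall y, y \in (W + <[e]>)%VS) ->
  has_dim A (\dim {:V}).-1.
Proof.
move=> Aa0 fA fe fullA; apply: (has_dim_intro Aa0).
  exists (lker (linfun f)); last first.
    by move=> x y Ax Ay; rewrite lker_linfun linearB /= !fA // subrr.
  have := limg_ker_dim (linfun f) {:V}; rewrite capfv => <-.
  suff -> : \dim (linfun f @: {:V}) = 1%N by rewrite addn1.
  apply/eqP; rewrite eqn_leq; apply/andP; split.
    by apply: leq_trans (dimvS (subvf _)) _; rewrite dimvf.
  rewrite lt0n dimv_eq0; apply/eqP => im0.
  have : linfun f e \in (linfun f @: {:V})%VS by rewrite memv_img // memvf.
  by rewrite im0 memv0 lfunE /= fe oner_eq0.
move=> W /fullA Wfull; rewrite -subn1 leq_subLR addnC.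
have : ({:V} <= W + <[e]>)%VS by apply/subvP => y _.
move=> /dimvS /leq_trans; apply; apply: leq_trans (dimv_add_leqif _ _) _.
by rewrite leq_add2l dim_vline leq_b1.
Qed.

(** The differences lie in both kernels, and the triangular values of [g1], [g2] keep [e1], [e2]
    independent modulo them. *)
Lemma has_dim_two_hyperplanes A n (g1 g2 : {linear V -> R^o}) b1 b2 e1 e2 :
  has_dim A n -> (forall a, A a -> g1 a = b1) -> (forall a, A a -> g2 a = b2) ->
  g1 e1 = 1 -> g1 e2 = 0 -> g2 e2 = 1 -> (n.+2 <= \dim {:V})%N.
Proof.
move=> [[v [vfree vA]] _] g1A g2A g11 g12 g22.
set X := [seq v (lift ord0 i) - v ord0 | i <- enum 'I_n] in vfree.
have Xker (g : {linear V -> R^o}) b : (forall a, A a -> g a = b) ->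
    {subset X <= lker (linfun g)}.
  by move=> gA _ /mapP[i _ ->]; rewrite lker_linfun linearB /= !gA // subrr.
have free2 : free (e1 :: e2 :: X).
  rewrite !free_cons vfree andbT; apply/andP; split; apply/negP => eX.
    have /subvP/(_ _ eX) : (<<e2 :: X>> <= lker (linfun g1))%VS.
      apply/span_subvP => y; rewrite inE => /predU1P[->|].
        by rewrite lker_linfun g12.
      exact: Xker g1A _.
    by rewrite lker_linfun g11 oner_eq0.
  have /subvP/(_ _ eX) : (<<X>> <= lker (linfun g2))%VS.
    by apply/span_subvP; exact: Xker g2A.
  by rewrite lker_linfun g22 oner_eq0.
have : size (e1 :: e2 :: X) = n.+2 by rewrite /= size_map size_enum_ord.
by move: free2; rewrite /free => /eqP + <- => <-; apply/dimvS/subvf.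
Qed.

(** Equality in the sum of two valid inequalities forces equality in both, so the face loses at
    least two dimensions. *)
Lemma not_facet (P : set V) (f g1 g2 : {linear V -> R^o}) b1 b2 e1 e2 :
  has_dim P (\dim {:V}) -> (forall y, f y = g1 y + g2 y) ->
  (forall y, P y -> g1 y <= b1) -> (forall y, P y -> g2 y <= b2) ->
  g1 e1 = 1 -> g1 e2 = 0 -> g2 e2 = 1 -> ~ defines_facet P f (b1 + b2).
Proof.
move=> dimP fE g1P g2P g11 g12 g22 [_ [n [dimP' dimF]]].
have := has_dim_two_hyperplanes (b1 := b1) (b2 := b2) dimF _ _ g11 g12 g22.
rewrite (has_dim_uniq dimP dimP') ltnn => h; suff : false by [].
by apply: h => y [Py /=]; rewrite fE; have := g1P _ Py; have := g2P _ Py; lra.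
Qed.

Lemma facet_intro (P : set V) (f : {linear V -> R^o}) b e y0 :
  has_dim P (\dim {:V}) -> (forall y, P y -> f y <= b) -> P y0 -> f y0 = b ->
  f e = 1 ->
  (forall W : {vspace V},
    (forall a c, P a -> f a = b -> P c -> f c = b -> a - c \in W) ->
    forall y, y \in (W + <[e]>)%VS) ->
  defines_facet P f b.
Proof.
move=> dimP fP Py0 fy0 fe fullF; split=> //; exists (\dim {:V}).-1.
have e0 : e != 0 by apply/eqP => e0; move: fe; rewrite e0 linear0 => /eqP; rewrite eq_sym oner_eq0.
have V0 : (0 < \dim {:V})%N.
  by have := dimvS (subvf <[e]>); rewrite dim_vline e0.
rewrite prednK //; split=> //.
apply: (has_dim_hyperplane (a0 := y0) (b := b)) fe _ => [|a []//|W FW] //.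
by apply: fullF => a c Pa fa Pc fc; apply: FW.
Qed.

End Dimension.

(** * Feasible points of the polyhedron *)

(** A 0/1 assignment is encoded as the set [z] of pairs with value 1, so lowering a variable is
    deleting a pair; [labelled z k] is the class of [k]. *)
Definition labelled {I L : finType} (z : {set I * L}) (k : L) : {set I} :=
  [set i | (i, k) \in z].

Definition single_label {I L : finType} (z : {set I * L}) :=
  forall i k k', (i, k) \in z -> (i, k') \in z -> k = k'.

Lemma sum_label_le1 (R : realType) (I L : finType) (z : {set I * L}) i :
  single_label z -> \sum_(k : L) ((i, k) \in z)%:R <= 1 :> R.
Proof.
move=> z1; have [/existsP[k kz]|/existsPn h] := boolP [exists k, (i, k) \in z].
  rewrite (bigD1 k) //= kz big1 ?addr0 // => k'.
  by case: (boolP ((i, k') \in z)) => // k'z; rewrite (z1 _ _ _ k'z kz) eqxx.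
by rewrite big1 // => k _; rewrite (negbTE (h k)).
Qed.

Definition all_labelled {I L : finType} (A : {set I}) (k : L) : {set I * L} :=
  [set t | (t.1 \in A) && (t.2 == k)].

Lemma labelled_all {I L : finType} (A : {set I}) (k k' : L) :
  labelled (all_labelled A k) k' = if k' == k then A else finset.set0.
Proof. by apply/setP => i; rewrite !inE /=; case: (k' == k); rewrite ?inE ?andbT ?andbF. Qed.

Lemma labelled_setU1 {I L : finType} (z : {set I * L}) i (k k' : L) :
  labelled ((i, k) |: z) k' = if k' == k then i |: labelled z k' else labelled z k'.
Proof.
apply/setP => h; rewrite !inE xpair_eqE.
by case: (k' == k); rewrite ?andbT ?andbF ?inE.
Qed.

Lemma single_label_all {I L : finType} (A : {set I}) (k : L) :
  single_label (all_labelled A k).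
Proof. by move=> i k1 k2; rewrite !inE /= => /andP[_ /eqP->] /andP[_ /eqP->]. Qed.

Lemma single_label_add {I L : finType} (A : {set I}) (k : L) i k' :
  i \notin A -> single_label ((i, k') |: all_labelled A k).
Proof.
move=> iA h k1 k2; rewrite !inE !xpair_eqE /=.
have [->|_] /= := eqVneq h i; last by move=> /andP[_ /eqP->] /andP[_ /eqP->].
by rewrite (negbTE iA) !orbF => /eqP-> /eqP->.
Qed.

Section InstancePolyhedron.
Context {R : realType} {d m : nat}.
Variables (x : 'I_m -> 'rV[R]_d) (Blue Red : {set 'I_m}) (LB LR : finType).

Local Notation vars := (@var_space R d m Blue Red LB LR).
Local Notation feas := (@feasible R d m x Blue Red LB LR).
Local Notation xB := (fun i : idx Blue => x (val i)).
Local Notation xR := (fun j : idx Red => x (val j)).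

Implicit Types (M : R) (P : {ffun LB * LR -> 'rV[R]_d}) (Q : {ffun LB * LR -> R^o}).
Implicit Types (zb : {set idx Blue * LB}) (zr : {set idx Red * LR}) (y : vars).
Implicit Types (A : {set idx Blue}) (C : {set idx Red}) (k : LB) (l : LR).

(** Arbitrary index sets make the obstacle inequality and the parts into which it splits instances
    of one linear form. *)
Definition zsum A k C l y : R^o :=
  \sum_(i in A) zB y i k + \sum_(j in C) zR y j l.

Lemma zsum_is_linear A k C l : linear (zsum A k C l).
Proof.
move=> a u v; rewrite /zsum scalerDr !scaler_sumr addrACA -!big_split.
by congr (_ + _); apply: eq_bigr => i _; rewrite /zB /zR /= !ffunE.
Qed.

HB.instance Definition _ A k C l :=
  GRing.isLinear.Build R vars R^o _ (zsum A k C l) (zsum_is_linear A k C l).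

(** The labels that some [(p, q)] completes to a feasible point when [M] is large. *)
Definition admissible zb zr :=
  [/\ single_label zb, single_label zr
    & forall k l, apart xB xR (labelled zb k) (labelled zr l)].

Definition pq_vars P Q : vars := (P, Q, 0, 0).

Definition point P Q zb zr : vars :=
  (P, Q, [ffun t => (t \in zb)%:R], [ffun t => (t \in zr)%:R]).

(** A label 1 turns the big-M bound into [- 1] or [1], a label 0 into [M] or [- M]. *)
Lemma feasible_point M P Q zb zr :
  single_label zb -> single_label zr ->
  (forall k l i, (i, k) \in zb -> dot (P (k, l)) (xB i) + Q (k, l) <= - 1) ->
  (forall k l j, (j, l) \in zr -> 1 <= dot (P (k, l)) (xR j) + Q (k, l)) ->
  (forall k l i, `|dot (P (k, l)) (x i) + Q (k, l)| <= M) ->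
  feas M (point P Q zb zr).
Proof.
move=> zb1 zr1 hb hr hM.
do ![split]; rewrite /zB /zR /pv /qv /=.
- by move=> i k; rewrite ffunE; case: (_ \in _); [right|left].
- by move=> i k; rewrite ffunE; case: (_ \in _); [right|left].
- move=> i k l; rewrite ffunE; have := hb k l i; have := hM k l (val i).
  rewrite ler_norml => /andP[_ h]; case: (_ \in zb) => [/(_ isT)|_] /=; lra.
- move=> j l k; rewrite ffunE; have := hr k l j; have := hM k l (val j).
  rewrite ler_norml => /andP[h _]; case: (_ \in zr) => [/(_ isT)|_] /=; lra.
- by move=> i; under eq_bigr do rewrite ffunE; apply: sum_label_le1.
- by move=> i; under eq_bigr do rewrite ffunE; apply: sum_label_le1.
Qed.

(** The margin 2 and the bound [M - 1] each exceed what feasibility asks for by 1, the room for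
    perturbations. *)
Definition separators (M : R) := forall A C, apart xB xR A C ->
  exists (p : 'rV[R]_d) (q : R),
    [/\ forall i, i \in A -> dot p (xB i) + q <= - 2,
        forall j, j \in C -> 2 <= dot p (xR j) + q
      & forall i, `|dot p (x i) + q| <= M - 1].

Lemma separators_exist : exists2 M0, 0 < M0 & forall M, M0 <= M -> separators M.
Proof.
have bound A C : exists b : R, 0 <= b /\ (apart xB xR A C ->
    exists (p : 'rV[R]_d) (q : R),
    [/\ forall i, i \in A -> dot p (xB i) + q <= - 2,
        forall j, j \in C -> 2 <= dot p (xR j) + q
      & forall i, `|dot p (x i) + q| <= b]).
  (* Pairs of sets that cannot be separated get the default bound 0; the bounds are then summed over
     all pairs. *)
  have [|h] := pselect (apart xB xR A C); last by exists 0.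
  move=> /finite_separation[p [q [pA pC]]].
  exists (\sum_i `|dot p (x i) + q|); split; first by apply: sumr_ge0.
  move=> _; exists p, q; split=> // i.
  by rewrite (bigD1 i) //= lerDl sumr_ge0.
have /choice[b boundP] : forall D : {set idx Blue} * {set idx Red}, exists b : R,
    0 <= b /\ (apart xB xR D.1 D.2 ->
    exists (p : 'rV[R]_d) (q : R),
    [/\ forall i, i \in D.1 -> dot p (xB i) + q <= - 2,
        forall j, j \in D.2 -> 2 <= dot p (xR j) + q
      & forall i, `|dot p (x i) + q| <= b]) by move=> D; apply: bound.
have b0 : 0 <= \sum_D b D by apply: sumr_ge0 => D _; case: (boundP D).
exists (1 + \sum_D b D); first by rewrite ltr_pwDl.
move=> M bM A C /(proj2 (boundP (A, C)))[p [q [pA pC pb]]].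
exists p, q; split=> // i; apply: le_trans (pb i) _.
have : b (A, C) <= \sum_D b D.
  by rewrite (bigD1 (A, C)) //= lerDl sumr_ge0 // => D _; case: (boundP D).
lra.
Qed.

(** Each pair [(k, l)] has its own [(p, q)], so the classes are separated pair by pair. The slack 1
    absorbs a small step in any direction [(P', Q')]. *)
Lemma admissible_feasible M zb zr : separators M -> admissible zb zr ->
  exists P Q, forall P' Q', exists2 e, 0 < e &
    feas M (point P Q zb zr) /\ feas M (point (P + e *: P') (Q + e *: Q') zb zr).
Proof.
move=> sepM [zb1 zr1 zap].
have /choice[F FP] : forall kl : LB * LR, exists pq : 'rV[R]_d * R,
    [/\ forall i, (i, kl.1) \in zb -> dot pq.1 (xB i) + pq.2 <= - 2,
        forall j, (j, kl.2) \in zr -> 2 <= dot pq.1 (xR j) + pq.2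
      & forall i, `|dot pq.1 (x i) + pq.2| <= M - 1].
  move=> [k l]; have [p [q [pA pC pM]]] := sepM _ _ (zap k l).
  by exists (p, q); split=> [i|j|]//= h; [apply: pA|apply: pC]; rewrite inE.
exists [ffun kl => (F kl).1], [ffun kl => (F kl).2 : R^o] => P' Q'.
pose s := \sum_kl \sum_i `|dot (P' kl) (x i) + Q' kl|.
have s0 : 0 <= s by do 2![apply: sumr_ge0 => ? _].
have sP kl i : `|dot (P' kl) (x i) + Q' kl| <= s.
  rewrite /s (bigD1 kl) //= (bigD1 i) //= -addrA lerDl addr_ge0 //.
    by apply: sumr_ge0.
  by do 2![apply: sumr_ge0 => ? _].
have e0 : 0 < (1 + s)^-1 by rewrite invr_gt0; lra.
exists (1 + s)^-1 => //; set e := (1 + s)^-1.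
have small kl i : `|e * (dot (P' kl) (x i) + Q' kl)| <= 1.
  rewrite normrM gtr0_norm // mulrC ler_pdivrMr ?mul1r; last by lra.
  by have := sP kl i; lra.
split; apply: feasible_point => // k l i; rewrite !ffunE ?dotDl ?dotZl.
- by move=> h; have [/(_ i h) + _ _] := FP (k, l); rewrite /=; lra.
- by move=> h; have [_ /(_ i h) + _] := FP (k, l); rewrite /=; lra.
- by have [_ _ /(_ i)] := FP (k, l); lra.
- move=> h; have [/(_ i h) + _ _] := FP (k, l).
  have := small (k, l) (val i); rewrite ler_norml => /andP[].
  by rewrite /= /GRing.scale /=; lra.
- move=> h; have [_ /(_ i h) + _] := FP (k, l).
  have := small (k, l) (val i); rewrite ler_norml => /andP[].
  by rewrite /= /GRing.scale /=; lra.
- have [_ _ /(_ i)] := FP (k, l); have := small (k, l) i.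
  rewrite !ler_norml => /andP[h1 h2] /andP[h3 h4]; apply/andP.
  by move: h1 h2 h3 h4; rewrite /= /GRing.scale /=; split; lra.
Qed.

Lemma feasible_zB_le1 M y i k : feas M y -> zB y i k <= 1.
Proof. by move=> [+ _] => /(_ i k) [] ->. Qed.

Lemma feasible_zR_le1 M y j l : feas M y -> zR y j l <= 1.
Proof. by move=> [_ [+ _]] => /(_ j l) [] ->. Qed.

Lemma sum_le_card (I : finType) (A : {set I}) (F : I -> R) :
  (forall i, F i <= 1) -> \sum_(i in A) F i <= #|A|%:R.
Proof. by move=> F1; rewrite -sum1_card natr_sum; apply: ler_sum => i _; apply: F1. Qed.

Lemma sum_le_card_pred (I : finType) (A : {set I}) (F : I -> R) i :
  (forall i, F i <= 1) -> i \in A -> F i = 0 -> \sum_(i in A) F i <= #|A|%:R - 1.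
Proof.
move=> F1 iA Fi; rewrite (big_setD1 i iA) /= Fi add0r (cardsD1 i) iA natrD.
by rewrite addrAC subrr add0r; apply: sum_le_card.
Qed.

(** If all these variables were 1, an affine function would be at most [- 1] on one hull and at
    least 1 on the other at a common point. So one variable is 0. *)
Lemma zsum_feasible_le M y A k C l : feas M y -> ~ apart xB xR A C ->
  zsum A k C l y <= #|A|%:R + #|C|%:R - 1.
Proof.
move=> fy /not_apartP[c [e [c0 e0 c1 e1 ce]]].
have zB1 i := feasible_zB_le1 i k fy; have zR1 j := feasible_zR_le1 j l fy.
have [/existsP[i /andP[iA /eqP zi]]|/existsPn zA] :=
    boolP [exists i, (i \in A) && (zB y i k == 0)].
  by rewrite addrAC lerD ?sum_le_card ?(sum_le_card_pred _ iA).
have [/existsP[j /andP[jC /eqP zj]]|/existsPn zC] :=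
    boolP [exists j, (j \in C) && (zR y j l == 0)].
  by rewrite -addrA lerD ?sum_le_card ?(sum_le_card_pred _ jC).
exfalso; have [zB01 [zR01 [hB [hR _]]]] := fy.
pose v z := dot (pv y k l) z + qv y k l.
have vA i : i \in A -> v (xB i) <= - 1.
  move=> iA; have := hB i k l; have := zA i; rewrite iA /=.
  by case: (zB01 i k) => -> ; rewrite ?eqxx // /v => _; lra.
have vC j : j \in C -> 1 <= v (xR j).
  move=> jC; have := hR j l k; have := zC j; rewrite jC /=.
  by case: (zR01 j l) => -> ; rewrite ?eqxx // /v => _; lra.
have vsum (I : finType) (D : {set I}) (w : I -> R) (u : I -> 'rV[R]_d) :
    \sum_(i in D) w i = 1 ->
    v (\sum_(i in D) w i *: u i) = \sum_(i in D) w i * v (u i).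
  move=> w1; rewrite /v dot_sumr; under [RHS]eq_bigr do rewrite mulrDr.
  rewrite big_split /= -mulr_suml w1 mul1r; congr (_ + _).
  by apply: eq_bigr => i _; rewrite dotZr.
have : v (\sum_(i in A) c i *: xB i) <= - 1.
  rewrite vsum // -[leRHS]mul1r -{1}c1 mulr_suml; apply: ler_sum => i iA.
  by apply: ler_wpM2l; [apply: c0|apply: vA].
have : 1 <= v (\sum_(j in C) e j *: xR j).
  rewrite vsum // -[leLHS]mul1r -{1}e1 mulr_suml; apply: ler_sum => i iC.
  by apply: ler_wpM2l; [apply: e0|apply: vC].
by rewrite ce; lra.
Qed.

End InstancePolyhedron.

(** * Directions between feasible points, and full dimension of the polyhedron *)

Section Directions.
Context {R : realType} {d m : nat}.
Variables (x : 'I_m -> 'rV[R]_d) (Blue Red : {set 'I_m}) (LB LR : finType).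

Local Notation vars := (@var_space R d m Blue Red LB LR).
Local Notation feas := (@feasible R d m x Blue Red LB LR).
Local Notation poly := (@polyhedron R d m x Blue Red LB LR).
Local Notation pq := (@pq_vars R d m Blue Red LB LR).
Local Notation seps := (@separators R d m x Blue Red).

Implicit Types (M : R) (P : {ffun LB * LR -> 'rV[R]_d}) (Q : {ffun LB * LR -> R^o}).
Implicit Types (zb : {set idx Blue * LB}) (zr : {set idx Red * LR}) (y : vars).
Implicit Types (A : {set idx Blue}) (C : {set idx Red}) (k : LB) (l : LR).

Definition unitB (t : idx Blue * LB) : vars := (0, 0, [ffun s => (s == t)%:R], 0).

Definition unitR (t : idx Red * LR) : vars := (0, 0, 0, [ffun s => (s == t)%:R]).

Lemma vars_span (W : {vspace vars}) :
  (forall P Q, pq P Q \in W) -> (forall t, unitB t \in W) ->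
  (forall t, unitR t \in W) -> forall y, y \in W.
Proof.
move=> Wpq WB WR y.
have -> : y = pq y.1.1.1 y.1.1.2 + \sum_t y.1.2 t *: unitB t
    + \sum_t y.2 t *: unitR t.
  have vars_eq (u v : vars) : u.1.1.1 = v.1.1.1 -> u.1.1.2 = v.1.1.2 ->
      u.1.2 = v.1.2 -> u.2 = v.2 -> u = v.
    by case: u v => [[[? ?] ?] ?] [[[? ?] ?] ?] /= -> -> -> ->.
  have sum1 (I : finType) (G : I -> vars) :
      (\sum_i G i).1.1.1 = \sum_i (G i).1.1.1 by exact: (big_morph (fun u : vars => u.1.1.1)).
  have sum2 (I : finType) (G : I -> vars) :
      (\sum_i G i).1.1.2 = \sum_i (G i).1.1.2 by exact: (big_morph (fun u : vars => u.1.1.2)).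
  have sum3 (I : finType) (G : I -> vars) :
      (\sum_i G i).1.2 = \sum_i (G i).1.2 by exact: (big_morph (fun u : vars => u.1.2)).
  have sum4 (I : finType) (G : I -> vars) :
      (\sum_i G i).2 = \sum_i (G i).2 by exact: (big_morph (fun u : vars => u.2)).
  have delta (I : finType) (z : {ffun I -> R^o}) :
      z = \sum_t z t *: [ffun s => (s == t)%:R : R^o].
    apply/ffunP => s; rewrite sum_ffunE (bigD1 s) //= big1 ?addr0 => [|t ts].
      by rewrite !ffunE eqxx /GRing.scale /= mulr1.
    by rewrite !ffunE eq_sym (negbTE ts) scaler0.
  apply: vars_eq.
  - rewrite /= sum1 sum1 !big1 ?addr0 // => t _; exact: scaler0.
  - rewrite /= sum2 sum2 !big1 ?addr0 // => t _; exact: scaler0.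
  - rewrite /= sum3 sum3 [in X in _ + X]big1 => [|t _]; last exact: scaler0.
    by rewrite addr0 add0r; apply: delta.
  - rewrite /= sum4 sum4 big1 => [|t _]; last exact: scaler0.
    by rewrite !add0r; apply: delta.
by rewrite !rpredD ?rpred_sum // => t _; rewrite rpredZ.
Qed.

Lemma direction_pq M (W : {vspace vars}) (F : set vars) zb zr :
  seps M -> admissible x zb zr ->
  (forall P Q, feas M (point P Q zb zr) -> F (point P Q zb zr)) ->
  (forall a b, F a -> F b -> a - b \in W) ->
  forall P Q, pq P Q \in W.
Proof.
move=> sepM adm FP FW P' Q'.
have [P [Q /(_ P' Q')[e e0 [f1 f2]]]] := admissible_feasible sepM adm.
have := FW _ _ (FP _ _ f2) (FP _ _ f1).
have -> : point (P + e *: P') (Q + e *: Q') zb zr - point P Q zb zr =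
    e *: pq P' Q'.
  by congr (_, _, _, _); apply/ffunP => t; rewrite !ffunE ?addrK ?subrr ?scaler0 // addrC addKr.
by rewrite rpredZeq gt_eqF.
Qed.

(** The two feasible points may differ in [(p, q)], but that part of the difference is already in
    [W] by [direction_pq]; only the labels remain. *)
Lemma direction_z M (W : {vspace vars}) (F : set vars) zb zr zb' zr' :
  seps M -> admissible x zb zr -> admissible x zb' zr' ->
  (forall P Q, feas M (point P Q zb zr) -> F (point P Q zb zr)) ->
  (forall P Q, feas M (point P Q zb' zr') -> F (point P Q zb' zr')) ->
  (forall a b, F a -> F b -> a - b \in W) ->
  point 0 0 zb zr - point 0 0 zb' zr' \in W.
Proof.
move=> sepM adm adm' FP FP' FW.
have [P [Q /(_ 0 0)[_ _ [f1 _]]]] := admissible_feasible sepM adm.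
have [P' [Q' /(_ 0 0)[_ _ [f2 _]]]] := admissible_feasible sepM adm'.
have := FW _ _ (FP _ _ f1) (FP' _ _ f2).
have -> : point P Q zb zr - point P' Q' zb' zr' =
    point 0 0 zb zr - point 0 0 zb' zr' + pq (P - P') (Q - Q').
  by congr (_, _, _, _); apply/ffunP => t; rewrite !ffunE ?subrr ?add0r ?addr0.
by rewrite rpredDr // (direction_pq sepM adm FP FW).
Qed.

Lemma admissible_subset zb zr zb' zr' :
  zb' \subset zb -> zr' \subset zr -> admissible x zb zr -> admissible x zb' zr'.
Proof.
move=> /fintype.subsetP sb /fintype.subsetP sr [zb1 zr1 zap]; split.
- by move=> i k k' /sb h /sb; apply: zb1 h.
- by move=> i k k' /sr h /sr; apply: zr1 h.
- move=> k l; apply: apart_subset (zap k l).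
  + by apply/fintype.subsetP => i; rewrite !inE; apply: sb.
  + by apply/fintype.subsetP => i; rewrite !inE; apply: sr.
Qed.

Lemma direction_unitB M (W : {vspace vars}) (F : set vars) zb zr t :
  seps M -> admissible x zb zr -> t \in zb ->
  (forall P Q, feas M (point P Q zb zr) -> F (point P Q zb zr)) ->
  (forall P Q, feas M (point P Q (zb :\ t) zr) -> F (point P Q (zb :\ t) zr)) ->
  (forall a b, F a -> F b -> a - b \in W) ->
  unitB t \in W.
Proof.
move=> sepM adm tz FP FP' FW.
have adm' : admissible x (zb :\ t) zr.
  by apply: admissible_subset adm => //; apply: finset.subD1set.
suff <- : point 0 0 zb zr - point 0 0 (zb :\ t) zr = unitB t.
  exact: direction_z sepM adm adm' FP FP' FW.
congr (_, _, _, _); apply/ffunP => s; rewrite !ffunE ?subrr //.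
by rewrite !inE; case: eqVneq => [->|_] /=; rewrite ?tz ?subr0 ?subrr.
Qed.

Lemma direction_unitR M (W : {vspace vars}) (F : set vars) zb zr t :
  seps M -> admissible x zb zr -> t \in zr ->
  (forall P Q, feas M (point P Q zb zr) -> F (point P Q zb zr)) ->
  (forall P Q, feas M (point P Q zb (zr :\ t)) -> F (point P Q zb (zr :\ t))) ->
  (forall a b, F a -> F b -> a - b \in W) ->
  unitR t \in W.
Proof.
move=> sepM adm tz FP FP' FW.
have adm' : admissible x zb (zr :\ t).
  by apply: admissible_subset adm => //; apply: finset.subD1set.
suff <- : point 0 0 zb zr - point 0 0 zb (zr :\ t) = unitR t.
  exact: direction_z sepM adm adm' FP FP' FW.
congr (_, _, _, _); apply/ffunP => s; rewrite !ffunE ?subrr //.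
by rewrite !inE; case: eqVneq => [->|_] /=; rewrite ?tz ?subr0 ?subrr.
Qed.

Lemma admissible_noR zb : single_label zb -> admissible x zb (finset.set0 : {set idx Red * LR}).
Proof.
move=> zb1; split=> // [i k k'|k l]; first by rewrite inE.
rewrite (_ : labelled finset.set0 l = finset.set0); first exact: apart0r.
by apply/setP => j; rewrite !inE.
Qed.

Lemma admissible_noB zr : single_label zr -> admissible x (finset.set0 : {set idx Blue * LB}) zr.
Proof.
move=> zr1; split=> // [i k k'|k l]; first by rewrite inE.
rewrite (_ : labelled finset.set0 k = finset.set0); first exact: apart0l.
by apply/setP => j; rewrite !inE.
Qed.

Lemma single_label1 (I L : finType) (t : I * L) : single_label [set t].
Proof. by move=> i k k'; rewrite !inE => /eqP <- /eqP[]. Qed.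

(** A single variable may be 1 on its own, since with the other colour unlabelled nothing has to be
    separated. *)
Lemma polyhedron_dim M : seps M -> has_dim (poly M) (\dim {:vars}).
Proof.
move=> sepM.
have sub y : feas M y -> poly M y by exact: mem_conv.
have adm0 : admissible x (finset.set0 : {set idx Blue * LB})
    (finset.set0 : {set idx Red * LR}).
  by apply: admissible_noR => i k k'; rewrite inE.
have [P [Q /(_ 0 0)[_ _ [f0 _]]]] := admissible_feasible sepM adm0.
apply: (has_dim_full (sub _ f0)) => W PW; apply: vars_span.
- exact: direction_pq sepM adm0 (fun P Q => sub _) PW.
- move=> t; apply: (direction_unitB sepM (admissible_noR (single_label1 (t := t)))
    _ (fun _ _ => sub _) (fun _ _ => sub _) PW).
  by rewrite inE.
- move=> t; apply: (direction_unitR sepM (admissible_noB (single_label1 (t := t)))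
    _ (fun _ _ => sub _) (fun _ _ => sub _) PW).
  by rewrite inE.
Qed.

End Directions.

(** * The directions of the face of a minimal crossing *)

Section Face.
Context {R : realType} {d m : nat}.
Variables (x : 'I_m -> 'rV[R]_d) (Blue Red : {set 'I_m}) (LB LR : finType).

Local Notation vars := (@var_space R d m Blue Red LB LR).
Local Notation feas := (@feasible R d m x Blue Red LB LR).
Local Notation seps := (@separators R d m x Blue Red).
Local Notation xB := (fun i : idx Blue => x (val i)).
Local Notation xR := (fun j : idx Red => x (val j)).

Implicit Types (M : R) (P : {ffun LB * LR -> 'rV[R]_d}) (Q : {ffun LB * LR -> R^o}).
Implicit Types (zb : {set idx Blue * LB}) (zr : {set idx Red * LR}) (y : vars).
Implicit Types (A : {set idx Blue}) (C : {set idx Red}) (k : LB) (l : LR).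

Lemma admissible_all A C k l :
  apart xB xR A C -> admissible x (all_labelled A k) (all_labelled C l).
Proof.
move=> AC; split; try exact: single_label_all.
move=> k' l'; rewrite !labelled_all; case: ifP => _; last exact: apart0l.
by case: ifP => _ //; apply: apart0r.
Qed.

(** The class of [k'] is just [i] and that of [k] remains [A], so two separations from [C]
    suffice. *)
Lemma admissible_addB A C k l i k' : apart xB xR A C -> k' != k -> i \notin A ->
  apart xB xR [set i] C ->
  admissible x ((i, k') |: all_labelled A k) (all_labelled C l).
Proof.
move=> AC kk iA iC; split; [exact: single_label_add|exact: single_label_all|].
move=> k1 l1; rewrite labelled_setU1 !labelled_all.
case: (l1 == l); last exact: apart0r.
have [->|_] := eqVneq k1 k'; first by rewrite (negbTE kk) finset.setU0.
by case: (k1 == k) => //; apply: apart0l.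
Qed.

Lemma admissible_addR A C k l j l' : apart xB xR A C -> l' != l -> j \notin C ->
  apart xB xR A [set j] ->
  admissible x (all_labelled A k) ((j, l') |: all_labelled C l).
Proof.
move=> AC ll jC Aj; split; [exact: single_label_all|exact: single_label_add|].
move=> k1 l1; rewrite labelled_setU1 !labelled_all.
case: (k1 == k); last exact: apart0l.
have [->|_] := eqVneq l1 l'; first by rewrite (negbTE ll) finset.setU0.
by case: (l1 == l) => //; apply: apart0r.
Qed.

Variables (S : {set idx Blue}) (j1 j2 : idx Red) (k : LB) (l : LR).
Hypothesis crossing : minimal_crossing xB xR S j1 j2.

(** Exactly one of the [#|S| + 2] variables of the inequality is 0. *)
Definition tight zb zr : Prop := (\sum_(i in S) ((i, k) \in zb) +
  \sum_(j in [set j1; j2]) ((j, l) \in zr) = #|S|.+1)%N.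

Lemma tight_missing_red zb zr h : h \in [set j1; j2] ->
  (forall i, i \in S -> (i, k) \in zb) ->
  (forall j, j \in [set j1; j2] -> ((j, l) \in zr) = (j == h)) -> tight zb zr.
Proof.
move=> hj zbS zrE; rewrite /tight -addn1; congr (_ + _)%N.
  by rewrite -sum1_card; apply: eq_bigr => i /zbS ->.
rewrite (big_setD1 h hj) /= zrE // eqxx big1 // => j.
by rewrite !in_setD1 => /andP[jh /zrE ->]; rewrite (negbTE jh).
Qed.

Lemma tight_missing_blue zb zr t : t \in S ->
  (forall i, i \in S -> ((i, k) \in zb) = (i != t)) ->
  (forall j, j \in [set j1; j2] -> (j, l) \in zr) -> tight zb zr.
Proof.
move=> tS zbE zrE; rewrite /tight (big_setD1 t tS) /= zbE // eqxx add0n.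
rewrite (cardsD1 t S) tS.
have -> : (\sum_(j in [set j1; j2]) ((j, l) \in zr) = 2)%N.
  rewrite (eq_bigr (fun=> 1%N)) => [|j /zrE -> //].
  by rewrite sum1_card cards2 (crossing_neq crossing).
rewrite (eq_bigr (fun=> 1%N)); first by rewrite sum1_card addn2.
by move=> i; rewrite in_setD1 => /andP[it /zbE ->]; rewrite it.
Qed.

Lemma tight_setD1B zb zr i k' :
  ~~ ((i \in S) && (k' == k)) -> tight zb zr -> tight (zb :\ (i, k')) zr.
Proof.
rewrite /tight => ik <-; congr (_ + _)%N; apply: eq_bigr => h hS.
rewrite !inE xpair_eqE; case: eqVneq => [hi|//]; case: eqVneq => [kk|//].
by move: ik; rewrite -hi hS kk eqxx.
Qed.

Lemma tight_setD1R zb zr j l' :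
  ~~ ((j \in [set j1; j2]) && (l' == l)) -> tight zb zr -> tight zb (zr :\ (j, l')).
Proof.
rewrite /tight => jl <-; congr (_ + _)%N; apply: eq_bigr => h hS.
rewrite !inE xpair_eqE; case: eqVneq => [hj|//]; case: eqVneq => [ll|//].
by move: jl; rewrite -hj hS ll eqxx.
Qed.

Lemma zsum_point P Q zb zr : tight zb zr ->
  zsum S k [set j1; j2] l (point P Q zb zr) = #|S|%:R + 1.
Proof.
rewrite natr1 /tight => <-; rewrite natrD !natr_sum /zsum; congr (_ + _).
  by apply: eq_bigr => i _; rewrite /zB /= ffunE.
by apply: eq_bigr => j _; rewrite /zR /= ffunE.
Qed.

Hypothesis x_inj : injective x.
Hypothesis disj_BR : [disjoint Blue & Red].
Hypothesis size_cond : (1 < #|S|)%N \/ #|LB| = 1%N.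

Lemma blue_red_apart (i : idx Blue) (j : idx Red) : apart xB xR [set i] [set j].
Proof.
apply: contrapT => /not_apart1P[c [_]]; rewrite !big_set1 => ->.
rewrite scale1r => /x_inj ij; have := disjointFr disj_BR (valP i).
by rewrite ij (valP j).
Qed.

(** A variable outside the inequality gives its unit vector by being lowered from 1 to 0 at a tight
    point. Those inside are compared by exchanging the missing one, which makes each unit vector
    equal to that of [(j1, l)] modulo [W]. *)
Lemma face_span M (F : set vars) (W : {vspace vars}) : seps M ->
  (forall zb zr P Q, tight zb zr -> feas M (point P Q zb zr) ->
    F (point P Q zb zr)) ->
  (forall a b, F a -> F b -> a - b \in W) ->
  forall y, y \in (W + <[unitR Blue LB (j1, l)]>)%VS.
Proof.
move=> sepM FP FW; set e := unitR _ _ _; set We := (W + _)%VS.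
have FPt zb zr : tight zb zr -> forall P Q, feas M (point P Q zb zr) ->
    F (point P Q zb zr) by move=> t P Q; apply: FP.
have subW v : v \in W -> v \in We by apply/subvP/addvSl.
have eW : e \in We by apply: (subvP (addvSr _ _)); apply: memv_line.
have newB zb zr i k' : ~~ ((i \in S) && (k' == k)) -> admissible x zb zr ->
    tight zb zr -> (i, k') \in zb -> unitB Red LR (i, k') \in We.
  move=> ik adm tz iz; apply/subW/(direction_unitB sepM adm iz (FPt _ _ tz) _ FW).
  by apply: FPt; apply: tight_setD1B.
have newR zb zr j l' : ~~ ((j \in [set j1; j2]) && (l' == l)) -> admissible x zb zr ->
    tight zb zr -> (j, l') \in zr -> unitR Blue LB (j, l') \in We.
  move=> jl adm tz jz; apply/subW/(direction_unitR sepM adm jz (FPt _ _ tz) _ FW).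
  by apply: FPt; apply: tight_setD1R.
have j1in : j1 \in [set j1; j2] by rewrite !inE eqxx.
have j2in : j2 \in [set j1; j2] by rewrite !inE eqxx orbT.
have apart_end h : h \in [set j1; j2] -> apart xB xR S [set h].
  rewrite !inE => /orP[] /eqP ->; first exact: crossing_outside1 crossing.
  exact: crossing_outside2 crossing.
have adm_end h hh := admissible_all k l (apart_end h hh).
have tight_end h : h \in [set j1; j2] ->
    tight (all_labelled S k) (all_labelled [set h] l).
  move=> hh; apply: (tight_missing_red hh) => [i iS|j _].
    by rewrite !inE iS eqxx.
  by rewrite !inE eqxx andbT.
have adm_del t tS := admissible_all k l (crossing_minimal crossing (t := t) tS).
have tight_del t : t \in S ->
    tight (all_labelled (S :\ t) k) (all_labelled [set j1; j2] l).
  move=> tS; apply: (tight_missing_blue tS) => [i iS|j jj].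
    by rewrite !inE iS eqxx !andbT.
  by rewrite inE jj eqxx.
apply: vars_span.
- move=> P Q; apply: subW.
  by apply: (direction_pq sepM (adm_end _ j1in) _ FW); apply: FPt; apply: tight_end.
- move=> [i k']; have [iS|iS] := boolP (i \in S); have [->|kk] := eqVneq k' k.
  (* The missing variable is that of [j1] in the first point and that of [i] in the second. *)
  + have -> : unitB Red LR (i, k) = point 0 0 (all_labelled S k) (all_labelled [set j2] l)
        - point 0 0 (all_labelled (S :\ i) k) (all_labelled [set j1; j2] l) + e.
      congr (_, _, _, _); apply/ffunP => -[h s]; rewrite !ffunE ?subrr ?addr0 //.
        rewrite !inE !xpair_eqE /=; case: eqVneq => [->|_] /=; last by rewrite subrr.
        by rewrite iS subr0; case: (_ == _).
      rewrite !inE !xpair_eqE /=; case: (s == l); rewrite ?andbF ?andbT ?subrr ?addr0 //.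
      case: (eqVneq h j1) => [->|_] /=; last by rewrite subrr addr0.
      by rewrite (negbTE (crossing_neq crossing)) sub0r addNr.
    apply: memvD (subW _ _) eW.
    exact: direction_z sepM (adm_end _ j2in) (adm_del _ iS)
      (FPt _ _ (tight_end _ j2in)) (FPt _ _ (tight_del _ iS)) FW.
  + have iC : apart xB xR [set i] [set j1; j2].
      (* [i] must receive [k'] instead of [k], so [x i] alone has to be
         separated from both red points. *)
      case: size_cond => [S1|LB1]; last first.
        have : (#|[set k; k']| <= #|LB|)%N by apply: max_card.
        by rewrite LB1 cards2 eq_sym kk.
      have [t] : exists t, t \in S :\ i.
        by apply/set0Pn; rewrite -card_gt0; move: S1; rewrite (cardsD1 i) iS.
      rewrite !inE => /andP[ti tS].
      apply: apart_subset (crossing_minimal crossing tS) => //.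
      by rewrite finset.sub1set !inE iS eq_sym ti.
    apply: (newB ((i, k') |: all_labelled (S :\ i) k) (all_labelled [set j1; j2] l)).
    * by rewrite (negbTE kk) andbF.
    * apply: admissible_addB => //; first exact: (crossing_minimal crossing iS).
      by rewrite !inE eqxx.
    * apply: (tight_missing_blue iS) => [h hS|j jj].
        by rewrite !inE xpair_eqE /= hS eqxx [k == k']eq_sym (negbTE kk) !andbT andbF.
      by rewrite inE jj eqxx.
    * by rewrite !inE eqxx.
  + have [h hh ah] := endpoints_apart_add crossing i.
    apply: (newB (all_labelled (i |: S) k) (all_labelled [set h] l)).
    * by rewrite (negbTE iS).
    * exact: admissible_all.
    * apply: (tight_missing_red hh) => [t tS|j _].
        by rewrite !inE tS eqxx orbT.
      by rewrite !inE eqxx andbT.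
    * by rewrite !inE !eqxx.
  (* Here [i] is alone in its class, and a blue point differs from the red point [j1]. *)
  + apply: (newB ((i, k') |: all_labelled S k) (all_labelled [set j1] l)).
    * by rewrite (negbTE iS).
    * by apply: admissible_addB => //; [exact: apart_end|exact: blue_red_apart].
    * apply: (tight_missing_red j1in) => [t tS|j _].
        by rewrite !inE tS eqxx orbT.
      by rewrite !inE eqxx andbT.
    * by rewrite !inE eqxx.
- move=> [j l']; have [jj|jj] := boolP (j \in [set j1; j2]); have [->|ll] := eqVneq l' l.
  + move: jj; rewrite !inE => /orP[/eqP->|/eqP->]; first exact: eW.
    have -> : unitR Blue LB (j2, l) = point 0 0 (all_labelled S k) (all_labelled [set j2] l)
        - point 0 0 (all_labelled S k) (all_labelled [set j1] l) + e.
      congr (_, _, _, _); apply/ffunP => -[h s]; rewrite !ffunE ?subrr ?addr0 //.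
      by rewrite !inE !xpair_eqE /= subrK.
    apply: memvD (subW _ _) eW.
    exact: direction_z sepM (adm_end _ j2in) (adm_end _ j1in)
      (FPt _ _ (tight_end _ j2in)) (FPt _ _ (tight_end _ j1in)) FW.
  (* The endpoint [j] gives up the label [l] for [l'], so it is the missing one and the other
     endpoint [h] keeps [l]. *)
  + have [h [hh jh]] : exists h, h \in [set j1; j2] /\ j != h.
      move: jj; rewrite !inE => /orP[] /eqP ->.
        by exists j2; split=> //; apply: crossing_neq crossing.
      by exists j1; split=> //; rewrite eq_sym; apply: crossing_neq crossing.
    apply: (newR (all_labelled S k) ((j, l') |: all_labelled [set h] l)).
    * by rewrite (negbTE ll) andbF.
    * by apply: admissible_addR => //; rewrite ?inE //; exact: apart_end.
    * apply: (tight_missing_red hh) => [t tS|s _].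
        by rewrite !inE tS eqxx.
      by rewrite !inE xpair_eqE /= eqxx [l == l']eq_sym (negbTE ll) andbF andbT.
    * by rewrite !inE eqxx.
  + have other h : h \in [set j1; j2] -> apart xB xR S [set h; j] ->
        unitR Blue LB (j, l) \in We.
      move=> hh ah; apply: (newR (all_labelled S k) (all_labelled [set h; j] l)).
      * by rewrite (negbTE jj).
      * exact: admissible_all.
      * apply: (tight_missing_red hh) => [t tS|s ss].
          by rewrite !inE tS eqxx.
        rewrite !inE eqxx andbT; case: (eqVneq s j) => [sj|_]; last by rewrite orbF.
        by move: jj; rewrite -sj ss.
      * by rewrite !inE !eqxx orbT.
    have [ah|ah|[t tS ah]] := crossing_apart_add crossing jj.
    * exact: other ah.
    * exact: other ah.
    * apply: (newR (all_labelled (S :\ t) k) (all_labelled (j |: [set j1; j2]) l)).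
      - by rewrite (negbTE jj).
      - exact: admissible_all.
      - apply: (tight_missing_blue tS) => [i iS|s ss].
          by rewrite !inE iS eqxx !andbT.
        by rewrite inE /= eqxx andbT inE ss orbT.
      - by rewrite !inE !eqxx.
  (* [x j] may lie in the hull of [S], so the missing variable is a blue one, chosen to free [j]. *)
  + have [t tS at_] := vertex_apart crossing j.
    apply: (newR (all_labelled (S :\ t) k) ((j, l') |: all_labelled [set j1; j2] l)).
    * by rewrite (negbTE jj).
    * by apply: admissible_addR => //; exact: (crossing_minimal crossing tS).
    * apply: (tight_missing_blue tS) => [i iS|s ss].
        by rewrite !inE iS eqxx !andbT.
      by rewrite finset.in_setU [X in _ || X]inE /= ss eqxx orbT.
    * by rewrite !inE eqxx.
Qed.

End Face.

(** * The obstacle inequality *)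

Section Obstacles.
Local Open Scope classical_set_scope.
Context {R : realType} {d m : nat}.
Variables (x : 'I_m -> 'rV[R]_d) (Blue Red : {set 'I_m}).
Local Notation xB := (fun i : idx Blue => x (val i)).
Local Notation xR := (fun j : idx Red => x (val j)).

Lemma image_pair (j1 j2 : idx Red) :
  [set xR j | j in [set` [set j1; j2]%SET]] = [set xR j1; xR j2].
Proof.
apply/seteqP; split=> [_ [j /= + <-]|_ [] ->].
- by rewrite !inE => /orP[] /eqP ->; [left|right].
- by exists j1 => //=; rewrite !inE eqxx.
- by exists j2 => //=; rewrite !inE eqxx orbT.
Qed.

Lemma points_setD1 (S : {set idx Blue}) t : injective x ->
  points x S `\ xB t = points x (S :\ t)%SET.
Proof.
move=> x_inj; apply/seteqP; split=> [_ [[i iS <-] /= it]|_ [i /= + <-]].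
  exists i => //=; rewrite !inE (iS : i \in S) andbT.
  by apply/eqP => ti; apply: it; rewrite ti.
rewrite !inE => /andP[/eqP it iS]; split; first by exists i.
by move=> /x_inj/val_inj.
Qed.

Lemma obstacle_apart (S : {set idx Blue}) (j1 j2 : idx Red) :
  obstacle (points x S) (x (val j1)) (x (val j2)) <->
  ~ apart xB xR S [set j1; j2]%SET.
Proof.
rewrite /obstacle /apart image_pair; split=> [/set0P/eqP//|h].
by apply/set0P/eqP.
Qed.

(** Injectivity of [x] makes deleting a point from [points x S] the same as deleting its index. *)
Lemma nontrivial_minimal_crossing (S : {set idx Blue}) (j1 j2 : idx Red) :
  injective x -> j1 <> j2 -> obstacle (points x S) (x (val j1)) (x (val j2)) ->
  (nontrivial_obstacle (points x S) (x (val j1)) (x (val j2)) /\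
   minimal_obstacle (points x S) (x (val j1)) (x (val j2))) <->
  minimal_crossing xB xR S j1 j2.
Proof.
move=> x_inj j12 obs; split=> [[[_ nt] [_ mi]]|cr].
  split; first by apply/eqP.
  - exact/obstacle_apart.
  - move=> t tS; rewrite /apart image_pair; have <- := mi (xB t).
      by rewrite points_setD1.
    by exists t.
  - by apply/apart1P => h; apply: nt; split=> //; left.
  - by apply/apart1P => h; apply: nt; split=> //; right.
split; split=> //.
  move=> [_ []] h.
    by have /apart1P := crossing_outside1 cr; apply.
  by have /apart1P := crossing_outside2 cr; apply.
move=> _ [t tS <-]; have := crossing_minimal cr (tS : t \in S).
by rewrite /apart image_pair points_setD1.
Qed.

End Obstacles.

(** * Validity of the inequality and the two implications *)

Section ObstacleInequality.
Context {R : realType} {d m : nat}.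
Variables (x : 'I_m -> 'rV[R]_d) (Blue Red : {set 'I_m}) (LB LR : finType).

Local Notation vars := (@var_space R d m Blue Red LB LR).
Local Notation poly := (@polyhedron R d m x Blue Red LB LR).
Local Notation seps := (@separators R d m x Blue Red).
Local Notation zsum := (@zsum R d m Blue Red LB LR).
Local Notation xB := (fun i : idx Blue => x (val i)).
Local Notation xR := (fun j : idx Red => x (val j)).

Implicit Types (A : {set idx Blue}) (C : {set idx Red}) (y : vars).

Variables (M : R) (S : {set idx Blue}) (j1 j2 : idx Red) (k : LB) (l : LR).
Hypothesis sepM : seps M.
Hypothesis S_meets : ~ apart xB xR S [set j1; j2].

Lemma zsum_polyhedron_le A C : ~ apart xB xR A C ->
  forall y, poly M y -> zsum A k C l y <= #|A|%:R + #|C|%:R - 1.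
Proof. by move=> AC1; apply: conv_linear_le => y fy; exact: zsum_feasible_le fy AC1. Qed.

Lemma zsum_polyhedron_le1 A C : (#|A| + #|C| = 1)%N ->
  forall y, poly M y -> zsum A k C l y <= 1.
Proof.
move=> AC1; apply: conv_linear_le => y fy.
rewrite -[leRHS]/(1%:R) -AC1 natrD; apply: lerD; apply: sum_le_card => i.
  exact: feasible_zB_le1 fy.
exact: feasible_zR_le1 fy.
Qed.

Lemma zsum_unitB A C i : zsum A k C l (unitB Red LR (i, k)) = (i \in A)%:R.
Proof.
rewrite /zsum [X in _ + X]big1 => [|j _]; last by rewrite /zR ffunE.
rewrite addr0; have zE h : zB (unitB Red LR (i, k)) h k = (h == i)%:R :> R.
  by rewrite /zB ffunE xpair_eqE eqxx andbT.
under eq_bigr do rewrite zE; have [iA|iA] := boolP (i \in A).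
  rewrite (bigD1 i) //= eqxx big1 ?addr0 // => h /andP[_ /negbTE ->] //.
by rewrite big1 // => h hA; case: eqVneq => // hi; rewrite -hi hA in iA.
Qed.

Lemma zsum_unitR A C j : zsum A k C l (unitR Blue LB (j, l)) = (j \in C)%:R.
Proof.
rewrite /zsum [X in X + _]big1 => [|i _]; last by rewrite /zB ffunE.
rewrite add0r; have zE h : zR (unitR Blue LB (j, l)) h l = (h == j)%:R :> R.
  by rewrite /zR ffunE xpair_eqE eqxx andbT.
under eq_bigr do rewrite zE; have [jC|jC] := boolP (j \in C).
  rewrite (bigD1 j) //= eqxx big1 ?addr0 // => h /andP[_ /negbTE ->] //.
by rewrite big1 // => h hC; case: eqVneq => // hj; rewrite -hj hC in jC.
Qed.

Lemma zsum_pair y : j1 != j2 ->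
  zsum S k [set j1; j2] l y = zR y j1 l + zR y j2 l + \sum_(i in S) zB y i k.
Proof. by move=> j12; rewrite /zsum big_setU1 ?inE // big_set1 addrC. Qed.

Lemma facet_crossing : j1 != j2 ->
  defines_facet (poly M) (zsum S k [set j1; j2] l) (#|S|%:R + 1) ->
  minimal_crossing xB xR S j1 j2.
Proof.
move=> j12 facet; have dimP := polyhedron_dim LB LR sepM.
(* If [x h] is in the hull of [S], the inequality splits into the bound [#|S|] for [S] with [h] and
   the bound 1 for the variable of [h']. *)
have outside h h' : h != h' -> [set j1; j2] = [set h; h'] -> apart xB xR S [set h].
  move=> hh eqh; apply: contrapT => /(zsum_polyhedron_le) le1.
  have le2 := @zsum_polyhedron_le1 finset.set0 [set h'] _.
  rewrite eqh in facet; move: facet; apply: (not_facet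
    (g1 := zsum S k [set h] l) (g2 := zsum finset.set0 k [set h'] l)
    (e1 := unitR Blue LB (h, l)) (e2 := unitR Blue LB (h', l)) dimP).
  - move=> y; rewrite /= /zsum big_setU1 ?inE // !big_set1 big_set0 add0r.
    by rewrite addrA.
  - by move=> y /le1; rewrite cards1 addrK.
  - by apply: le2; rewrite cards0 cards1.
  - by rewrite /= zsum_unitR inE eqxx.
  - by rewrite /= zsum_unitR inE eq_sym (negbTE hh).
  - by rewrite /= zsum_unitR inE eqxx.
split=> //; last 2 first.
- exact: outside j12 _.
- by apply: (outside j2 j1); rewrite 1?eq_sym // finset.setUC.
(* If [S :\ t] still crosses, it has the bound [#|S|] together with both red points, and the
   variable of [t] has the bound 1. *)
move=> t tS; apply: contrapT => /(zsum_polyhedron_le) le1.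
have le2 := @zsum_polyhedron_le1 [set t] finset.set0 _.
move: facet; apply: (not_facet
  (g1 := zsum (S :\ t) k [set j1; j2] l) (g2 := zsum [set t] k finset.set0 l)
  (e1 := unitR Blue LB (j1, l)) (e2 := unitB Red LR (t, k)) dimP).
- move=> y; rewrite /= /zsum (big_setD1 t tS) /= big_set0 big_set1 addr0.
  by rewrite -addrA addrC.
- move=> y /le1; rewrite cards2 j12 (cardsD1 t S) tS natrD /=; lra.
- by apply: le2; rewrite cards0 cards1.
- by rewrite /= zsum_unitR !inE eqxx.
- by rewrite /= zsum_unitB !inE eqxx.
- by rewrite /= zsum_unitB inE eqxx.
Qed.

Lemma crossing_facet : injective x -> [disjoint Blue & Red] ->
  (1 < #|S|)%N \/ #|LB| = 1%N -> minimal_crossing xB xR S j1 j2 ->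
  defines_facet (poly M) (zsum S k [set j1; j2] l) (#|S|%:R + 1).
Proof.
move=> x_inj disj size_cond cr; have j12 := crossing_neq cr.
(* Labels of a first point of the face, with the variable of [j1] missing. *)
have tE : tight S j1 j2 k l (all_labelled S k) (all_labelled [set j2] l).
  apply: (@tight_missing_red _ _ _ _ _ S j1 j2 k l _ _ j2) => [|i iS|j _].
  - by rewrite !inE eqxx orbT.
  - by rewrite !inE iS eqxx.
  - by rewrite !inE eqxx andbT.
have [P [Q /(_ 0 0)[_ _ [f0 _]]]] :=
  admissible_feasible sepM (admissible_all k l (crossing_outside2 cr)).
apply: (facet_intro (polyhedron_dim LB LR sepM) _ (mem_conv f0) (zsum_point _ _ tE)
  (e := unitR Blue LB (j1, l))).
- move=> y Py; have := zsum_polyhedron_le S_meets Py.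
  by rewrite cards2 j12 /=; lra.
- by rewrite /= zsum_unitR !inE eqxx.
move=> W PW.
apply: (face_span (k := k) cr x_inj disj size_cond (M := M)
  (F := fun y => poly M y /\ zsum S k [set j1; j2] l y = #|S|%:R + 1)) => //.
- by move=> zb zr P' Q' tz fz; split; [exact: (mem_conv fz)|exact: zsum_point].
- by move=> a b [Pa fa] [Pb fb]; apply: PW.
Qed.

End ObstacleInequality.

(* The side condition on the "if" part cannot be dropped: if S = {i} and k' <> k
   are two groups of LB, every point of the face has z_{ik'} = 0, so that the
   face is not a facet although S may be a nontrivial minimal obstacle. *)
Theorem theorem2 (R : realType) (d m : nat) (x : 'I_m -> 'rV[R]_d)
    (Blue Red : {set 'I_m}) (LB LR : finType)
    (x_inj : injective x)
    (cover_BR : Blue :|: Red = [set: 'I_m]%SET)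
    (disj_BR : [disjoint Blue & Red]) :
  exists M0 : R, 0 < M0 /\
  forall M : R, M0 <= M ->
  forall (S : {set idx Blue}) (j1 j2 : idx Red) (k : LB) (l : LR),
    j1 <> j2 ->
    obstacle (points x S) (x (val j1)) (x (val j2)) ->
    let facet :=
      defines_facet (@polyhedron R d m x Blue Red LB LR M)
        (fun y => zR y j1 l + zR y j2 l + \sum_(i in S) zB y i k)
        (#|S|%:R + 1) in
    let nontrivial_minimal :=
      nontrivial_obstacle (points x S) (x (val j1)) (x (val j2)) /\
      minimal_obstacle (points x S) (x (val j1)) (x (val j2)) in
    (facet -> nontrivial_minimal) /\
    ((1 < #|S|)%N \/ #|LB| = 1%N -> nontrivial_minimal -> facet).
Proof.
have [M0 M0_gt0 sepM0] := @separators_exist R d m x Blue Red.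
exists M0; split=> // M /sepM0 sepM S j1 j2 k l /eqP j12 obs facet nontrivial_minimal.
have S_meets := (obstacle_apart x S j1 j2).1 obs.
have crossingE := nontrivial_minimal_crossing x_inj (elimN eqP j12) obs.
have facetE : facet = defines_facet (@polyhedron R d m x Blue Red LB LR M)
    (zsum S k [set j1; j2]%SET l) (#|S|%:R + 1).
  by congr (defines_facet _ _ _); apply/funext => y; rewrite zsum_pair.
rewrite facetE; split=> [/(facet_crossing sepM S_meets j12)/crossingE //|].
by move=> size_cond /crossingE; apply: crossing_facet.
Qed.
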